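(* Fix $\alpha\in[0,1)$ and $\beta\in(0,1)$, and put $Q=1-\alpha$, $S=1-\beta$. Let $\nu_n^{\alpha,\beta}$ be the stationary law of the count chain of the combined clumsy-careless collector and $\mu_n^{\alpha,\beta}:=\mathbb P_{\nu_n^{\alpha,\beta}}(K_0<n,K_1=n)$. Then $\mu_n^{\alpha,\beta}\sim\frac{1}{(S;S)_\infty}\frac{n!}{n^n}Q^nS^{n(n+1)/2}$. If $T_n^{\alpha,\beta}$ is the first post-thinning completion time from the empty collection, then $\mu_n^{\alpha,\beta}T_n^{\alpha,\beta}\Rightarrow\mathrm{Exp}(1)$, and for every fixed $r\ge1$, $\mathbb E(\mu_n^{\alpha,\beta}T_n^{\alpha,\beta})^r\to r!$. Consequently $\mathbb ET_n^{\alpha,\beta}\sim(S;S)_\infty\frac{n^n}{n!}Q^{-n}S^{-n(n+1)/2}$ and $\mathrm{Var}(T_n^{\alpha,\beta})\sim(S;S)_\infty^2\left(\frac{n^n}{n!}\right)^2Q^{-2n}S^{-n(n+1)}$.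
   Context: Combined clumsy-careless collector on $n$ types: the state is the set of present types, starting from $\emptyset$. In each round one type is drawn uniformly from $[n]$ independently of the past; the selected type is refreshed to present with probability $Q$ and to absent with probability $\alpha$; after this, every currently present coupon is independently retained with probability $S$ (lost with probability $\beta$). Completion is checked after this thinning step: $T_n^{\alpha,\beta}$ is the first round after which all $n$ types are present. $K_t$ is the number of present types after thinning at time $t$; it is a Markov chain on $\{0,\dots,n\}$: given $K_t=k$, with probability $k/n$, $K_{t+1}\sim\mathrm{Bin}(k-1,S)+\mathrm{Bernoulli}(QS)$ and with probability $(n-k)/n$, $K_{t+1}\sim\mathrm{Bin}(k,S)+\mathrm{Bernoulli}(QS)$ (independent summands; the first case is absent when $k=0$). It is irreducible and aperiodic with unique stationary law $\nu_n^{\alpha,\beta}$. $(S;S)_\infty:=\prod_{r=1}^\infty(1-S^r)$. *)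

(* Defs.v *)
From HB Require Import structures.
From mathcomp Require Import all_boot all_order all_algebra.
From mathcomp Require Import all_classical all_reals all_analysis.
Set Implicit Arguments. Unset Strict Implicit. Unset Printing Implicit Defensive.
Import Order.TTheory GRing.Theory Num.Theory.
Import numFieldNormedType.Exports.
Local Open Scope classical_set_scope.
Local Open Scope ring_scope.

Section Collector.
Variable R : realType.

(* pmf of Bin(m,p) at j (zero for j > m since 'C(m,j) = 0) *)
Definition binpmf (m : nat) (p : R) (j : nat) : R :=
  'C(m, j)%:R * p ^+ j * (1 - p) ^+ (m - j).

Definition binbern (m : nat) (p q : R) (j : nat) : R :=
  binpmf m p j * (1 - q) + (if j is j'.+1 then binpmf m p j' * q else 0).

(* Transition kernel of the count chain K on {0,..,n}, with Q = 1 - alpha,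
   S = 1 - beta.  From k: with prob k/n, K' ~ Bin(k-1,S)+Bern(QS); with prob
   (n-k)/n, K' ~ Bin(k,S)+Bern(QS).  (For k = 0 the first case has weight 0.) *)
Definition trans (alpha beta : R) (n k j : nat) : R :=
  let Q := 1 - alpha in let S := 1 - beta in
  (k%:R / n%:R) * binbern k.-1 S (Q * S) j
  + ((n - k)%:R / n%:R) * binbern k S (Q * S) j.

Definition stationary (alpha beta : R) (n : nat) (nu : nat -> R) : Prop :=
  (forall j, (j <= n)%N -> 0 <= nu j) /\
  \sum_(0 <= j < n.+1) nu j = 1 /\
  (forall j, (j <= n)%N -> nu j = \sum_(0 <= k < n.+1) nu k * trans alpha beta n k j).

Definition mu (alpha beta : R) (n : nat) (nu : nat -> R) : R :=
  \sum_(0 <= k < n) nu k * trans alpha beta n k n.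

(* killed n t j = P_0(K_1 < n, ..., K_t < n, K_t = j)  for j < n *)
Fixpoint killed (alpha beta : R) (n t j : nat) : R :=
  match t with
  | 0 => if j == 0%N then 1 else 0
  | t'.+1 => if (j < n)%N then
      \sum_(0 <= i < n) killed alpha beta n t' i * trans alpha beta n i j
      else 0
  end.

(* pT n t = P(T_n = t), T_n = first t >= 1 with K_t = n, started from K_0 = 0 *)
Definition pT (alpha beta : R) (n t : nat) : R :=
  match t with
  | 0 => 0
  | t'.+1 => \sum_(0 <= i < n) killed alpha beta n t' i * trans alpha beta n i n
  end.

(* E[f(T_n)] for a nonnegative f, as an extended real *)
Definition expect (alpha beta : R) (n : nat) (f : nat -> R) : \bar R :=
  (\sum_(0 <= t <oo) ((f t * pT alpha beta n t)%:E))%E.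

Definition qpoch (S : R) : R :=
  limn (fun m => \prod_(1 <= r < m.+1) (1 - S ^+ r)).

Definition asympt (u v : nat -> R) : Prop :=
  (fun n => u n / v n) @ \oo --> (1 : R).

Definition exp1_cdf (x : R) : R := if x < 0 then 0 else 1 - expR (- x).

End Collector.

(* Main.v *)
Require Import Defs.
From HB Require Import structures.
From mathcomp Require Import all_boot all_order all_algebra.
From mathcomp Require Import all_classical all_reals all_analysis.
From mathcomp Require Import ring lra.
Import Order.TTheory GRing.Theory Num.Theory.
Import numFieldNormedType.Exports.
Local Open Scope classical_set_scope.
Local Open Scope ring_scope.
Set Implicit Arguments.
Unset Strict Implicit.
Unset Printing Implicit Defensive.

(* The binomial moments b_j(t) = E C(K_t, j) satisfy a triangular two-term
   recursion with nonnegative coefficients and diagonal S^j (1 - j/n).  Solving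
   it in the stationary regime gives nu(n) = b_n as an explicit product, hence
   mu = nu(n) (1 - Q S^n), and its denominator converges to (S;S)_oo.  The same
   recursion contracts: started from 0 the mass of n at time t is nu(n) - e_t,
   started from n it is nu(n) + d_t, with 0 <= e_t, d_t <= S^(n-1+t) (t >= 1 for
   d).  Decomposing at the first visit of n, with f_s = P(T = s) and
   h_t = P(T > t), the renewal equation becomes
     sum_(s <= t) f_s d_(t-s) = nu(n) h_t - e_t,   d_0 = 1 - nu(n).
   Dropping nonnegative terms yields h_t >= (1 - nu(n))^t; feeding this back
   into the convolution yields h_t <= (1 + o(1)) q^t with (1 - q) ~ nu(n).  The
   two geometric tails have the same exponential limit, and their rising
   factorial moments are r! nu(n)^-r and r! (1 - q)^-r. *)

(** * Binomial moments of the chain *)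

Section BinomialMoments.
Variable R : realType.
Implicit Types (p q : R) (m i j n N : nat).

Lemma binpmf_ge0 m p j : 0 <= p <= 1 -> 0 <= binpmf m p j.
Proof.
move=> /andP[p0 p1]; rewrite /binpmf !mulr_ge0 ?exprn_ge0 ?ler0n//.
by rewrite subr_ge0.
Qed.

Lemma binbern_ge0 m p q j : 0 <= p <= 1 -> 0 <= q <= 1 -> 0 <= binbern m p q j.
Proof.
move=> hp /andP[q0 q1]; rewrite /binbern addr_ge0//.
  by rewrite mulr_ge0 ?binpmf_ge0 ?subr_ge0.
by case: j => // j; rewrite mulr_ge0 ?binpmf_ge0.
Qed.

Lemma binpmf_small m p j : (m < j)%N -> binpmf m p j = 0.
Proof. by move=> mj; rewrite /binpmf bin_small// !mul0r. Qed.

(** Pascal's rule: one more trial is a Bernoulli summand with the same parameter. This drives the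
    induction on [m] in [binpmf_mom]. *)
Lemma binpmfS m p j : binpmf m.+1 p j = binbern m p p j.
Proof.
rewrite /binbern /binpmf; case: j => [|j].
  by rewrite !bin0 !expr0 !subn0 exprSr; ring.
rewrite binS subSS natrD.
case: (ltnP j m) => jm; last by rewrite (bin_small (n := m) (m := j.+1))//; rewrite exprSr; ring.
by rewrite -(subnSK jm) !exprSr; ring.
Qed.

Lemma binbern_sum m p q N :
  \sum_(0 <= i < N.+1) binbern m p q i =
  (1 - q) * \sum_(0 <= i < N.+1) binpmf m p i + q * \sum_(0 <= i < N) binpmf m p i.
Proof.
elim: N => [|N IH]; first by rewrite !big_nat1 big_geq// /binbern; ring.
rewrite big_nat_recr//= IH !(big_nat_recr N.+1)//= !(big_nat_recr N)//= {1}/binbern /=; ring.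
Qed.

Lemma binbern_mom_sum m p q N j :
  \sum_(0 <= i < N.+1) binbern m p q i * 'C(i, j.+1)%:R =
  (1 - q) * \sum_(0 <= i < N.+1) binpmf m p i * 'C(i, j.+1)%:R
  + q * \sum_(0 <= i < N) binpmf m p i * 'C(i.+1, j.+1)%:R.
Proof.
elim: N => [|N IH]; first by rewrite !big_nat1 big_geq// bin_small//; ring.
rewrite big_nat_recr//= IH !(big_nat_recr N.+1)//= !(big_nat_recr N)//= {1}/binbern /=; ring.
Qed.

Lemma binpmf_mom m p N j : (m <= N)%N ->
  \sum_(0 <= i < N.+1) binpmf m p i * 'C(i, j)%:R = 'C(m, j)%:R * p ^+ j.
Proof.
elim: m N j => [|m IH] N j mN.
  rewrite big_nat_recl//= big1 ?addr0; last first.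
    by move=> i _; rewrite binpmf_small// mul0r.
  rewrite /binpmf binn subnn !expr0 !mul1r.
  by case: j => [|j]; rewrite ?expr0 ?mulr1// bin0n mul0r.
case: N mN => // N mN; case: j => [|j].
  under eq_bigr do rewrite bin0 mulr1 binpmfS.
  rewrite binbern_sum.
  have E M : (m <= M)%N -> \sum_(0 <= i < M.+1) binpmf m p i = 1.
    move=> mM; have := IH _ 0%N mM; rewrite bin0 expr0 mulr1 => E0; apply: etrans E0.
    by apply: eq_bigr => i _; rewrite bin0 mulr1.
  by rewrite !E// ?bin0 ?expr0; [ring|exact: ltnW].
under eq_bigr do rewrite binpmfS.
rewrite binbern_mom_sum.
under [in X in _ + X]eq_bigr do rewrite binS natrD mulrDr.
rewrite big_split /= !IH ?(ltnW mN)// binS natrD exprS; ring.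
Qed.

Lemma binbern_mom0 m p q N : (m < N)%N ->
  \sum_(0 <= i < N.+1) binbern m p q i = 1.
Proof.
move=> mN; rewrite binbern_sum.
have E M : (m <= M)%N -> \sum_(0 <= i < M.+1) binpmf m p i = 1.
  move=> mM; have := @binpmf_mom m p M 0 mM; rewrite bin0 expr0 mulr1 => E0; apply: etrans E0.
  by apply: eq_bigr => i _; rewrite bin0 mulr1.
by case: N mN => // N mN; rewrite !E ?(ltnW mN)//; ring.
Qed.

Lemma binbern_momS m p q N j : (m < N)%N ->
  \sum_(0 <= i < N.+1) binbern m p q i * 'C(i, j.+1)%:R =
  'C(m, j.+1)%:R * p ^+ j.+1 + q * ('C(m, j)%:R * p ^+ j).
Proof.
case: N => // N mN; rewrite binbern_mom_sum.
under [in X in _ + X]eq_bigr do rewrite binS natrD mulrDr.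
rewrite big_split /= !binpmf_mom ?(ltnW mN)//; ring.
Qed.

End BinomialMoments.

(** * One step of the chain acting on binomial moments *)

Section Chain.
Variables (R : realType) (alpha beta : R).
Hypotheses (ha0 : 0 <= alpha) (ha1 : alpha < 1) (hb0 : 0 < beta) (hb1 : beta < 1).
Let Q := 1 - alpha.
Let S := 1 - beta.
Implicit Types (n j k t : nat) (v : nat -> R).

(* momdiag and momshift are the coefficients of the bidiagonal recursion
   E C(K_{t+1}, j+1) = momdiag (j+1) E C(K_t, j+1) + momshift j E C(K_t, j). *)
Definition momdiag n j : R := S ^+ j * (1 - j%:R / n%:R).
Definition momshift n j : R := S ^+ j.+1 * Q * (1 - j%:R / n%:R).

Let S01 : 0 < S < 1. Proof. by rewrite /S subr_gt0 hb1/= gtrBl. Qed.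
Let Q01 : 0 < Q <= 1. Proof. by rewrite /Q subr_gt0 ha1/= gerBl. Qed.

Lemma trans_ge0 n k j : 0 <= trans alpha beta n k j.
Proof.
case/andP: S01 => s0 s1; case/andP: Q01 => q0 q1.
have hS : 0 <= S <= 1 by rewrite !ltW.
have hQS : 0 <= Q * S <= 1.
  by rewrite mulr_ge0 ?mulr_ile1 // ltW.
rewrite /trans; apply: addr_ge0; apply: mulr_ge0; rewrite ?divr_ge0 ?binbern_ge0//.
Qed.

Lemma trans_sum1 n k : (0 < n)%N -> (k <= n)%N ->
  \sum_(0 <= j < n.+1) trans alpha beta n k j = 1.
Proof.
move=> n0 kn; have nR : (n%:R : R) != 0 by rewrite pnatr_eq0 -lt0n.
rewrite big_split /= -!mulr_sumr.
have -> : (k%:R / n%:R : R) * (\sum_(0 <= j < n.+1) binbern k.-1 (1 - beta) ((1 - alpha) * (1 - beta)) j) = k%:R / n%:R.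
  case: k kn => [|k] kn; first by rewrite !mul0r.
  by rewrite binbern_mom0// mulr1.
have -> : ((n - k)%:R / n%:R : R) * (\sum_(0 <= j < n.+1) binbern k (1 - beta) ((1 - alpha) * (1 - beta)) j) = (n - k)%:R / n%:R.
  (* At [k = n] the law [binbern n] charges [n + 1], outside the range of summation, but then its
     weight [n - k] is zero. *)
  case: (ltnP k n) => [kn'|nk]; first by rewrite binbern_mom0// mulr1.
  by rewrite (eqP nk) !mul0r.
by rewrite natrB//; field.
Qed.

(** The difference is taken in [R], so [j > k] is covered as well: both sides then vanish. *)
Lemma mul_bin_pred k j : k%:R * 'C(k.-1, j)%:R = (k%:R - j%:R) * 'C(k, j)%:R :> R.
Proof.
case: (leqP j k) => jk; last first.
  by rewrite !bin_small ?mulr0//; apply: leq_ltn_trans jk; exact: leq_pred.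
by rewrite -natrB// -!natrM mul_bin_down.
Qed.

(** Removing the selected coupon with probability [k/n] averages the binomial coefficient to
    [(1 - j/n) 'C(k, j)], by [mul_bin_pred]; thinning contributes the powers of [S], and the
    Bernoulli summand the lower moment. *)
Lemma trans_mom n k j : (0 < n)%N -> (k <= n)%N ->
  \sum_(0 <= i < n.+1) trans alpha beta n k i * 'C(i, j.+1)%:R =
  momdiag n j.+1 * 'C(k, j.+1)%:R + momshift n j * 'C(k, j)%:R.
Proof.
move=> n0 kn; have nR : (n%:R : R) != 0 by rewrite pnatr_eq0 -lt0n.
under eq_bigr do rewrite mulrDl -!mulrA.
rewrite big_split /= -!mulr_sumr.
have -> : (k%:R : R) * (n%:R^-1 * (\sum_(0 <= i < n.+1) binbern k.-1 (1 - beta) ((1 - alpha) * (1 - beta)) i * 'C(i, j.+1)%:R)) =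
    n%:R^-1 * (S ^+ j.+1 * (k%:R * 'C(k.-1, j.+1)%:R + Q * (k%:R * 'C(k.-1, j)%:R))).
  case: k kn => [|k] kn; first by rewrite !mul0r !(mulr0,addr0).
  by rewrite binbern_momS// -/Q -/S exprS; ring.
have -> : ((n - k)%:R : R) * (n%:R^-1 * (\sum_(0 <= i < n.+1) binbern k (1 - beta) ((1 - alpha) * (1 - beta)) i * 'C(i, j.+1)%:R)) =
    n%:R^-1 * (n%:R - k%:R) * S ^+ j.+1 * ('C(k, j.+1)%:R + Q * 'C(k, j)%:R).
  case: (ltnP k n) => [kn'|nk].
    by rewrite binbern_momS// -/Q -/S natrB// exprS; ring.
  by rewrite (eqP nk); have -> : k = n; [apply/eqP; rewrite eqn_leq kn nk|ring].
rewrite !mul_bin_pred /momdiag /momshift -[j.+1%:R]natr1; field.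
by [].
Qed.

Fixpoint law n v t j : R :=
  if t is t'.+1 then \sum_(0 <= k < n.+1) law n v t' k * trans alpha beta n k j
  else v j.

Definition mom n v j : R := \sum_(0 <= k < n.+1) v k * 'C(k, j)%:R.

(** This is the way back from moments to probabilities: completion only involves the mass at [n]. *)
Lemma mom_top n v : mom n v n = v n.
Proof.
rewrite /mom big_nat_recr//= binn mulr1 big_nat big1 ?add0r//.
by move=> k /andP[_ kn]; rewrite bin_small// mulr0.
Qed.

(** Stated for any [w] that agrees with the image of [v] on [0..n], so as to apply both to a step of
    [law] and, with [w = v], to a stationary law. *)
Lemma mom_step n v w j : (0 < n)%N ->
  (forall j, (j <= n)%N -> w j = \sum_(0 <= k < n.+1) v k * trans alpha beta n k j) ->
  mom n w j.+1 = momdiag n j.+1 * mom n v j.+1 + momshift n j * mom n v j.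
Proof.
move=> n0 hw; rewrite /mom.
transitivity (\sum_(0 <= i < n.+1) \sum_(0 <= k < n.+1)
    v k * trans alpha beta n k i * 'C(i, j.+1)%:R).
  by apply: eq_big_nat => i /andP[_ ?]; rewrite hw// mulr_suml.
rewrite exchange_big_nat /= !mulr_sumr -big_split /=; apply: eq_big_nat => k /andP[_ kn].
under eq_bigr do rewrite -mulrA.
by rewrite -mulr_sumr trans_mom//; ring.
Qed.

Lemma mom0_step n v w : (0 < n)%N ->
  (forall j, (j <= n)%N -> w j = \sum_(0 <= k < n.+1) v k * trans alpha beta n k j) ->
  mom n w 0 = mom n v 0.
Proof.
move=> n0 hw; rewrite /mom.
transitivity (\sum_(0 <= i < n.+1) \sum_(0 <= k < n.+1)
    v k * trans alpha beta n k i).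
  by apply: eq_big_nat => i /andP[_ ?]; rewrite hw// bin0 mulr1.
rewrite exchange_big_nat /=; apply: eq_big_nat => k /andP[_ kn].
by rewrite -mulr_sumr trans_sum1// bin0.
Qed.

End Chain.

(** * Stationary law and renewal equation *)

Section Renewal.
Variables (R : realType) (alpha beta : R).
Hypotheses (ha0 : 0 <= alpha) (ha1 : alpha < 1) (hb0 : 0 < beta) (hb1 : beta < 1).
Variables (n : nat) (nu : nat -> R).
Hypotheses (n0 : (0 < n)%N) (hnu : stationary alpha beta n nu).
Let Q := 1 - alpha.
Let S := 1 - beta.
Local Notation lam := (momdiag beta n).
Local Notation kap := (momshift alpha beta n).
Local Notation law := (law alpha beta n).
Local Notation pT := (pT alpha beta n).
Implicit Types (j k t : nat).

Let S01 : 0 < S < 1. Proof. by rewrite /S subr_gt0 hb1/= gtrBl. Qed.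
Let Q01 : 0 < Q <= 1. Proof. by rewrite /Q subr_gt0 ha1/= gerBl. Qed.
Let nR : 0 < (n%:R : R). Proof. by rewrite ltr0n. Qed.

Let frac_ge0 j : (j <= n)%N -> 0 <= 1 - j%:R / n%:R :> R.
Proof. by move=> jn; rewrite subr_ge0 ler_pdivrMr// mul1r ler_nat. Qed.

Lemma momdiag_ge0 j : (j <= n)%N -> 0 <= lam j.
Proof.
move=> jn; case/andP: S01 => s0 _.
by rewrite /momdiag mulr_ge0 ?frac_ge0 ?exprn_ge0// ltW.
Qed.

Lemma momdiag_le j : lam j <= S ^+ j.
Proof.
case/andP: S01 => s0 _.
by rewrite /momdiag ler_piMr ?exprn_ge0 ?(ltW s0)// gerBl divr_ge0.
Qed.

Lemma momdiagS_lt1 j : lam j.+1 < 1.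
Proof.
case/andP: S01 => s0 s1.
by rewrite (le_lt_trans (momdiag_le _))// exprn_ilt1 ?ltW.
Qed.

Lemma momshift_ge0 j : (j <= n)%N -> 0 <= kap j.
Proof.
move=> jn; case/andP: S01 => s0 _; case/andP: Q01 => q0 _.
by rewrite /momshift mulr_ge0 ?frac_ge0// mulr_ge0 ?exprn_ge0 ?ltW.
Qed.

(** The weights ['C(n, j)] shrink by [S] under the recursion: with [y = (j + 1)/n], the identity
    [(n - j) 'C(n, j) = (j + 1) 'C(n, j + 1)] turns the left side into
    [S^(j+1) (1 - y + Q y) 'C(n, j + 1)], and [Q <= 1]. *)
Lemma momstep_bin j : (j < n)%N ->
  lam j.+1 * 'C(n, j.+1)%:R + kap j * 'C(n, j)%:R <= S * 'C(n, j.+1)%:R.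
Proof.
move=> jn; case/andP: S01 => s0 s1; case/andP: Q01 => q0 q1.
have binE : (n%:R - j%:R) * 'C(n, j)%:R = j.+1%:R * 'C(n, j.+1)%:R :> R.
  by rewrite -natrB 1?ltnW// -!natrM mul_bin_left.
have -> : kap j * 'C(n, j)%:R =
    S ^+ j.+1 * (Q * (j.+1%:R / n%:R)) * 'C(n, j.+1)%:R.
  rewrite /momshift -/S -/Q.
  transitivity (S ^+ j.+1 * Q / n%:R * ((n%:R - j%:R) * 'C(n, j)%:R)).
    by field; rewrite gt_eqF.
  by rewrite binE; field; rewrite gt_eqF.
rewrite /momdiag -/S -mulrDl ler_wpM2r// -mulrDr exprS -mulrA ler_piMr ?(ltW s0)//.
rewrite mulr_ile1 ?exprn_ge0 ?exprn_ile1 ?(ltW s0) ?(ltW s1)//.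
  by rewrite addr_ge0 ?frac_ge0// mulr_ge0 ?divr_ge0 ?(ltW q0).
have y0 : 0 <= j.+1%:R / n%:R :> R by rewrite divr_ge0.
by have := ler_piMl y0 q1; lra.
Qed.

Section Contraction.
Variable g : nat -> nat -> R.
Hypothesis g_step : forall t j, (j < n)%N ->
  g t.+1 j.+1 = lam j.+1 * g t j.+1 + kap j * g t j.
Hypothesis g_0 : forall t, g t 0 = 0.
Hypothesis g_init : forall j, (j <= n)%N -> 0 <= g 0 j <= 'C(n, j)%:R.

(** [g] stands for the difference of the moments of two laws: it obeys the same linear recursion and
    has zero mass, which keeps the source at [j = 0] empty. Nonnegative coefficients preserve the
    sign, [momstep_bin] the weighted bound. *)
Lemma contraction t j : (j <= n)%N -> 0 <= g t j <= 'C(n, j)%:R * S ^+ t.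
Proof.
elim: t j => [|t IH] j jn; first by rewrite expr0 mulr1 g_init.
case/andP: S01 => s0 s1.
case: j jn => [|j] jn; first by rewrite g_0 lexx/= mulr_ge0 ?exprn_ge0 ?(ltW s0).
have /andP[a0 a1] := IH _ jn; have /andP[c0 c1] := IH _ (ltnW jn).
have d0 := momdiag_ge0 jn; have m0 := momshift_ge0 (ltnW jn).
rewrite g_step// addr_ge0/= ?(mulr_ge0 d0) ?(mulr_ge0 m0)//.
apply: le_trans (_ : lam j.+1 * ('C(n, j.+1)%:R * S ^+ t)
   + kap j * ('C(n, j)%:R * S ^+ t) <= _).
  by rewrite lerD// ler_wpM2l.
rewrite !mulrA -mulrDl exprS mulrA ler_wpM2r ?exprn_ge0 ?(ltW s0)//.
by rewrite [X in _ <= X]mulrC momstep_bin.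
Qed.

(** At the top [lam n = 0], so only the shift survives, and its factor [1/n] cancels the [n] from
    ['C(n, n - 1)]. *)
Lemma top_step (a c x : R) : c <= n%:R * x -> 0 <= x ->
  lam n * a + kap n.-1 * c <= S ^+ n * x.
Proof.
move=> cx x0; case/andP: S01 => s0 s1; case/andP: Q01 => q0 q1.
have n1E : (n.-1%:R : R) = n%:R - 1 by rewrite -subn1 natrB.
have -> : lam n = 0 by rewrite /momdiag divff ?gt_eqF// subrr mulr0.
have -> : kap n.-1 = S ^+ n * Q / n%:R.
  by rewrite /momshift prednK// n1E -/S -/Q; field; rewrite gt_eqF.
rewrite mul0r add0r -2!mulrA ler_wpM2l ?exprn_ge0 ?(ltW s0)//.
rewrite (le_trans (y := Q * (n%:R^-1 * (n%:R * x))))//.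
  by rewrite -mulrA; apply: ler_wpM2l; [exact: ltW|apply: ler_wpM2l; rewrite ?invr_ge0// ltW].
by rewrite mulKf ?gt_eqF// ler_piMl.
Qed.

(** The last step goes through [top_step] and gains [S ^+ n] instead of [S]; this makes the errors
    vanish as [n] grows, not only as [t] grows. *)
Lemma contraction_top t : 0 <= g t.+1 n <= S ^+ n * S ^+ t.
Proof.
case/andP: S01 => s0 _; have /andP[-> _] /= := contraction t.+1 (leqnn n).
have n1n : (n.-1 < n)%N by rewrite prednK.
have := g_step t n1n; rewrite prednK// => ->.
apply: top_step; last by rewrite exprn_ge0 ?ltW.
have /andP[_] := contraction t (ltnW n1n).
by rewrite -{2}(prednK n0) binSn prednK.
Qed.

End Contraction.

Definition dirac_pmf k j : R := (j == k)%:R.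

Lemma law_step v t j : (0 < j)%N -> (j <= n)%N ->
  mom n (law v t.+1) j = lam j * mom n (law v t) j + kap j.-1 * mom n (law v t) j.-1.
Proof. by case: j => // j _ jn; rewrite (mom_step (alpha := alpha) (beta := beta) (v := law v t)). Qed.

Lemma law_mom0 v t : mom n (law v t) 0 = mom n v 0.
Proof. by elim: t => // t IH; rewrite (mom0_step (alpha := alpha) (beta := beta) (v := law v t)). Qed.

Lemma mom_dirac k j : (k <= n)%N -> mom n (dirac_pmf k) j = 'C(k, j)%:R.
Proof.
move=> kn; rewrite /mom (bigD1_seq k) ?mem_index_iota ?iota_uniq//=.
rewrite /dirac_pmf eqxx mul1r big1 ?addr0// => i /negbTE ->.
by rewrite mul0r.
Qed.

Lemma stationary_ge0 j : (j <= n)%N -> 0 <= nu j.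
Proof. by case: hnu => h _; apply: h. Qed.

Lemma stationary_mom0 : mom n nu 0 = 1.
Proof.
case: hnu => _ [<- _]; apply: eq_bigr => i _.
by rewrite bin0 mulr1.
Qed.

Lemma stationary_momS j :
  mom n nu j.+1 = lam j.+1 * mom n nu j.+1 + kap j * mom n nu j.
Proof. by apply: mom_step => // i; case: hnu => _ [_]; apply. Qed.

Lemma stationary_mom_bounds j : 0 <= mom n nu j <= 'C(n, j)%:R.
Proof.
apply/andP; split.
  by rewrite /mom big_nat sumr_ge0// => i /andP[_ ?]; rewrite mulr_ge0 ?stationary_ge0.
case: hnu => _ [s1 _].
have -> : 'C(n, j)%:R = \sum_(0 <= i < n.+1) nu i * 'C(n, j)%:R.
  by rewrite -mulr_suml s1 mul1r.
apply: ler_sum_nat => i /andP[_ ?]; apply: ler_wpM2l; first exact: stationary_ge0.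
by rewrite ler_nat leq_bin2l.
Qed.

Lemma stationary_momE j : (j <= n)%N ->
  mom n nu j = \prod_(0 <= i < j) (kap i / (1 - lam i.+1)).
Proof.
elim: j => [|j IH] jn; first by rewrite big_geq// stationary_mom0.
rewrite big_nat_recr//= -IH; last exact: ltnW.
have d1 : 1 - lam j.+1 != 0 by rewrite subr_eq0 gt_eqF// momdiagS_lt1.
have := stationary_momS j => h.
apply: (mulIf d1); rewrite mulrA mulfVK// [RHS]mulrC mulrBr mulr1.
by rewrite {1}h; ring.
Qed.

Lemma stationary_top_gt0 : 0 < nu n.
Proof.
rewrite -mom_top stationary_momE// big_nat; apply: prodr_gt0 => i /andP[_ jn].
rewrite divr_gt0 ?subr_gt0 ?momdiagS_lt1//.
case/andP: S01 => s0 _; case/andP: Q01 => q0 _.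
by rewrite /momshift !mulr_gt0 ?exprn_gt0// subr_gt0 ltr_pdivrMr// mul1r ltr_nat.
Qed.

Lemma stationary_top_le : nu n <= S ^+ n.
Proof.
rewrite -mom_top -{2}(prednK n0) stationary_momS prednK// -[X in _ <= X]mulr1.
apply: top_step => //; rewrite mulr1.
have /andP[_] := stationary_mom_bounds n.-1.
by rewrite -{3}(prednK n0) binSn prednK.
Qed.

(** The errors [e_t] (started from [0]) and [d_t] (restarted from [n]) of the renewal equation. *)
Definition stat_gap t := nu n - law (dirac_pmf 0) t n.
Definition return_gap t := law (dirac_pmf n) t n - nu n.

Lemma stat_gap_bounds t : 0 <= stat_gap t <= S ^+ n.-1 * S ^+ t.
Proof.
case/andP: S01 => s0 s1.
case: t => [|t].
  rewrite expr0 mulr1 /stat_gap/= /dirac_pmf gtn_eqF//= subr0 ltW ?stationary_top_gt0//=.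
  rewrite (le_trans stationary_top_le)// ler_wiXn2l ?leq_pred ?(ltW s0) ?(ltW s1)//.
(* Trades [S ^+ n.-1 * S ^+ t.+1] for [S ^+ n * S ^+ t], the form delivered by [contraction_top]. *)
rewrite -exprD addnS -addSn prednK// exprD.
rewrite /stat_gap -(mom_top n nu) -(mom_top n (law (dirac_pmf 0) t.+1)).
apply: (contraction_top (g := fun t j => mom n nu j - mom n (law (dirac_pmf 0) t) j)).
- move=> u j jn; rewrite {1}stationary_momS (law_step _ _ (ltn0Sn j))//=; ring.
- by move=> u; rewrite law_mom0 stationary_mom0 mom_dirac// bin0 subrr.
- move=> j jn /=; rewrite mom_dirac//; case: j jn => [|j] jn.
    by rewrite stationary_mom0 bin0 subrr lexx ler0n.
  by rewrite bin0n subr0 stationary_mom_bounds.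
Qed.

Lemma return_gap0 : return_gap 0 = 1 - nu n.
Proof. by rewrite /return_gap/= /dirac_pmf eqxx. Qed.

(** The moments from state [n] are ['C(n, j)], the largest possible, so they dominate the stationary
    ones. Time [0] is excluded, since [return_gap 0 = 1 - nu n] is not small. *)
Lemma return_gap_bounds t : 0 <= return_gap t.+1 <= S ^+ n.-1 * S ^+ t.+1.
Proof.
rewrite -exprD addnS -addSn prednK// exprD.
rewrite /return_gap -(mom_top n nu) -(mom_top n (law (dirac_pmf n) t.+1)).
apply: (contraction_top (g := fun t j => mom n (law (dirac_pmf n) t) j - mom n nu j)).
- move=> u j jn; rewrite {1}stationary_momS (law_step _ _ (ltn0Sn j))//=; ring.
- by move=> u; rewrite law_mom0 stationary_mom0 mom_dirac// bin0 subrr.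
- move=> j jn /=; have /andP[b0 b1] := stationary_mom_bounds j.
  by rewrite mom_dirac// subr_ge0 b1 gerBl.
Qed.

Lemma killed_ge0 t j : 0 <= killed alpha beta n t j.
Proof.
elim: t j => [|t IH] j /=; first by case: ifP.
by case: ifP => // _; apply: sumr_ge0 => i _; rewrite mulr_ge0 ?trans_ge0.
Qed.

Lemma pT_ge0 t : 0 <= pT t.
Proof.
by case: t => [|t] //=; apply: sumr_ge0 => i _; rewrite mulr_ge0 ?killed_ge0 ?trans_ge0.
Qed.

Lemma killed_top t : killed alpha beta n t n = 0.
Proof. by case: t => [|t] /=; rewrite ?gtn_eqF ?ltnn. Qed.

(** Decomposition at the first visit of [n]: either it has not occurred by time [t], or it occurred
    at [s] and the chain restarted from [n]. *)
Lemma law_renewal t j : (j <= n)%N ->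
  law (dirac_pmf 0) t j = killed alpha beta n t j
    + \sum_(0 <= s < t.+1) pT s * law (dirac_pmf n) (t - s) j.
Proof.
elim: t j => [|t IH] j jn.
  by rewrite big_nat1 mul0r addr0 /= /dirac_pmf; case: eqP.
transitivity (\sum_(0 <= k < n.+1) killed alpha beta n t k * trans alpha beta n k j
   + \sum_(0 <= s < t.+1) pT s * law (dirac_pmf n) (t.+1 - s) j).
  transitivity (\sum_(0 <= k < n.+1) (killed alpha beta n t k * trans alpha beta n k j
     + \sum_(0 <= s < t.+1) pT s * law (dirac_pmf n) (t - s) k * trans alpha beta n k j)).
    rewrite [LHS]/=; apply: eq_big_nat => k /andP[_ kn].
    by rewrite IH// mulrDl mulr_suml.
  rewrite big_split /=; congr (_ + _).
  rewrite exchange_big_nat /=; apply: eq_big_nat => s /andP[_ st].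
  rewrite subSn//= mulr_sumr; apply: eq_bigr => k _.
  by rewrite mulrA.
rewrite big_nat_recr//= killed_top mul0r addr0.
rewrite [in RHS]big_nat_recr//= subnn /= /dirac_pmf.
rewrite [RHS]addrCA addrC; congr (_ + _).
(* The mass leaving [killed t] lands either below [n], where it is [killed t.+1 j], or at [n], where
   it is the new term [pT t.+1]. *)
case: (ltngtP j n) jn => // [jn|->] _; first by rewrite mulr0 addr0.
by rewrite mulr1 add0r.
Qed.

Lemma renewal_top t :
  \sum_(0 <= s < t.+1) pT s * (nu n + return_gap (t - s)) = nu n - stat_gap t.
Proof.
rewrite /stat_gap subKr law_renewal// killed_top add0r.
by apply: eq_bigr => s _; rewrite /return_gap addrCA subrr addr0.
Qed.

(** By stationarity the flow into [n] from below is [nu n] minus the mass that stays at [n]; staying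
    means a successful refresh and survival of all [n] coupons, of probability [Q * S ^+ n]. *)
Lemma mu_stationary : mu alpha beta n nu = nu n * (1 - Q * S ^+ n).
Proof.
have nun : nu n = \sum_(0 <= k < n.+1) nu k * trans alpha beta n k n.
  by case: hnu => _ [_]; apply.
have -> : mu alpha beta n nu = nu n - nu n * trans alpha beta n n n.
  by rewrite {1}nun big_nat_recr//= addrK.
suff -> : trans alpha beta n n n = Q * S ^+ n by rewrite mulrBr mulr1.
rewrite /trans subnn mul0r mul0r addr0 divff ?gt_eqF// mul1r -/S -/Q.
case: n n0 => // m _; rewrite /binbern /= binpmf_small// /binpmf binn subnn expr0 exprS.
ring.
Qed.

End Renewal.

(** * Tails from a renewal equation *)

Section RenewalTail.
Variable R : realType.
Implicit Types (f d e h a b : nat -> R) (x p q : R) (s t N : nat).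

Lemma geometric_sum_le p N : 0 <= p < 1 -> \sum_(0 <= t < N) p ^+ t <= (1 - p)^-1.
Proof.
case/andP=> p0 p1.
have p1' : 0 < 1 - p by rewrite subr_gt0.
rewrite -[X in _ <= X]mul1r ler_pdivlMr// mulrC.
suff -> : (1 - p) * \sum_(0 <= t < N) p ^+ t = 1 - p ^+ N by rewrite gerBl exprn_ge0.
elim: N => [|N IH]; first by rewrite big_geq// mulr0 expr0 subrr.
by rewrite big_nat_recr//= mulrDr IH exprS; ring.
Qed.

Lemma sum_convolution a b N :
  \sum_(0 <= t < N) \sum_(0 <= s < t.+1) a s * b (t - s)%N =
  \sum_(0 <= s < N) a s * \sum_(0 <= m < N - s) b m.
Proof.
elim: N => [|N IH]; first by rewrite !big_geq.
rewrite big_nat_recr//= IH.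
have -> : \sum_(0 <= s < N) a s * \sum_(0 <= m < N - s) b m =
    \sum_(0 <= s < N.+1) a s * \sum_(0 <= m < N - s) b m.
  by rewrite big_nat_recr//= subnn (big_geq (leqnn 0)) mulr0 addr0.
rewrite -big_split /=; apply: eq_big_nat => s /andP[_ sN].
by rewrite subSn// big_nat_recr//= mulrDr.
Qed.

(** For [f] the law of [T], the tail [P(T > t)] through a finite sum; that [f] has total mass one
    comes out as the decay of this tail. *)
Definition survival f t : R := 1 - \sum_(0 <= s < t.+1) f s.

Lemma survivalS f t : survival f t - survival f t.+1 = f t.+1.
Proof. by rewrite /survival [in X in _ - X]big_nat_recr//=; ring. Qed.

Variables (S v A : R) (f d e : nat -> R).
Hypotheses (S01 : 0 < S < 1) (v01 : 0 < v < 1) (A0 : 0 <= A).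
Hypotheses (f0 : f 0%N = 0) (f_ge0 : forall t, 0 <= f t).
Hypotheses (d0 : d 0%N = 1 - v) (dS : forall t, 0 <= d t.+1 <= A * S ^+ t.+1).
Hypothesis e_bounds : forall t, 0 <= e t <= A * S ^+ t.
Hypothesis renewal : forall t,
  \sum_(0 <= s < t.+1) f s * (v + d (t - s)%N) = v - e t.
Let h := survival f.

Let d_ge0 t : 0 <= d t.
Proof. by case: t => [|t]; [rewrite d0 subr_ge0 ltW//; case/andP: v01|case/andP: (dS t)]. Qed.

Lemma survival0 : h 0%N = 1.
Proof. by rewrite /h /survival big_nat1 f0 subr0. Qed.

Lemma renewal_survival t : \sum_(0 <= s < t.+1) f s * d (t - s)%N = v * h t - e t.
Proof.
have := renewal t; under eq_bigr do rewrite mulrDr.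
rewrite big_split /= -mulr_suml /h /survival => H.
by apply: (addrI ((\sum_(0 <= s < t.+1) f s) * v)); rewrite H; ring.
Qed.

(* Keep only the term s = t + 1 of [renewal_survival]; the others are nonnegative. *)
Lemma survival_hazard t : (1 - v) * f t.+1 <= v * h t.+1.
Proof.
have := renewal_survival t.+1; rewrite big_nat_recr//= subnn d0 => H.
have : 0 <= \sum_(0 <= s < t.+1) f s * d (t.+1 - s)%N.
  by apply: sumr_ge0 => s _; rewrite mulr_ge0.
have /andP[+ _] := e_bounds t.+1.
by move: H; lra.
Qed.

Lemma survival_ratio t : (1 - v) * h t <= h t.+1.
Proof. by have := survival_hazard t; rewrite -survivalS -/h; lra. Qed.

Lemma survival_ge t : (1 - v) ^+ t <= h t.
Proof.
elim: t => [|t IH]; first by rewrite expr0 survival0.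
apply: le_trans (survival_ratio t); rewrite exprS ler_wpM2l//.
by rewrite subr_ge0 ltW//; case/andP: v01.
Qed.

Lemma survival_ge0 t : 0 <= h t.
Proof.
by apply: le_trans (survival_ge t); rewrite exprn_ge0// subr_ge0 ltW//; case/andP: v01.
Qed.

Lemma survival_ratio_iter s t : (1 - v) ^+ t * h s <= h (t + s)%N.
Proof.
elim: t => [|t IH]; first by rewrite expr0 mul1r.
apply: le_trans (survival_ratio _); rewrite exprS -mulrA ler_wpM2l//.
by rewrite subr_ge0 ltW//; case/andP: v01.
Qed.

(** * Upper tail bound with the sharp rate *)

Section SharpUpper.
Variable rho : R.
Hypotheses (rho01 : 0 < rho < 1) (S_rho : S <= rho * (1 - v)).
Let delta := A / ((1 - v) * (1 - rho)).
Hypothesis delta_le : delta <= 2^-1.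
(** In [renewal_survival] at [t + 1], bounding the earlier returns by [v * delta * h t.+1] leaves
    [(1 - v * delta) h t.+1 <= (1 - v) h t + e t.+1]; this is the resulting ratio. *)
Definition decay_rate := (1 - v) / (1 - v * delta).

Let v1 : 0 < 1 - v. Proof. by case/andP: v01; rewrite subr_gt0. Qed.
Let r1 : 0 < 1 - rho. Proof. by case/andP: rho01; rewrite subr_gt0. Qed.
Let delta0 : 0 <= delta. Proof. by rewrite divr_ge0// ltW// mulr_gt0. Qed.
Let vd : 2^-1 <= 1 - v * delta.
Proof.
case/andP: v01 => v0 /ltW v1'.
by have : v * delta <= 1 * 2^-1; [rewrite ler_pM// ltW|lra].
Qed.

(* The hazard bound gives f s <= v/(1-v) h s, and [survival_ratio_iter] replaces
   h s by h (t+1) at the price of (1-v)^-(t+1-s), absorbed by S <= rho (1-v). *)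
Lemma return_mass_le t :
  \sum_(0 <= s < t.+1) f s * d (t.+1 - s)%N <= v * delta * h t.+1.
Proof.
case/andP: v01 => v0 _; case/andP: S01 => s0 _; case/andP: rho01 => r0 _.
apply: (@le_trans _ _ (\sum_(0 <= s < t.+1)
    v / (1 - v) * A * h t.+1 * rho ^+ (t.+1 - s))).
  apply: ler_sum_nat => s /andP[_ st].
  have fs : f s <= v / (1 - v) * h s.
    rewrite mulrAC ler_pdivlMr// mulrC; case: s st => [|s] _; last exact: survival_hazard.
    by rewrite f0 mulr0 mulr_ge0 ?survival_ge0// ltW.
  have ds : d (t.+1 - s) <= A * (rho * (1 - v)) ^+ (t.+1 - s).
    rewrite subSn//; have /andP[_ h1] := dS (t - s); apply: le_trans h1 _.
    by rewrite ler_wpM2l// lerXn2r ?nnegrE ?(ltW s0) ?mulr_ge0 ?(ltW r0) ?(ltW v1).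
  apply: le_trans (ler_pM (f_ge0 _) (d_ge0 _) fs ds) _.
  have := survival_ratio_iter s (t.+1 - s); rewrite subnK 1?ltnW// => hs.
  rewrite exprMn.
  rewrite [X in X <= _](_ : _ = v / (1 - v) * A * rho ^+ (t.+1 - s) * ((1 - v) ^+ (t.+1 - s) * h s)); last by ring.
  rewrite [X in _ <= X]mulrAC ler_wpM2l// !mulr_ge0 ?exprn_ge0 ?invr_ge0// ltW//.
rewrite -mulr_sumr.
have -> : v * delta * h t.+1 = v / (1 - v) * A * h t.+1 * (1 - rho)^-1.
  by rewrite /delta; field; rewrite !gt_eqF.
apply: ler_wpM2l; first by rewrite !mulr_ge0 ?survival_ge0 ?invr_ge0// ltW.
apply: le_trans (geometric_sum_le t.+2 _); last by rewrite (ltW r0); case/andP: rho01.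
rewrite [in X in _ <= X]big_nat_recl// ler_wpDl ?expr0//.
rewrite big_nat_rev /= add0n; apply: ler_sum_nat => s /andP[_ st].
by rewrite subKn.
Qed.

(** [delta <= 1/2] gives [1 - v * delta >= 1/2], so dividing the error by it costs at most the
    factor [2]. *)
Lemma survival_step t :
  h t.+1 <= decay_rate * h t + 2 * A * S ^+ t.+1.
Proof.
case/andP: S01 => s0 _.
have := renewal_survival t.+1; rewrite big_nat_recr//= subnn d0 -survivalS -/h => H.
have := return_mass_le t; have /andP[_ E] := e_bounds t.+1.
move=> D; have vd0 : 0 < 1 - v * delta by apply: lt_le_trans vd; rewrite invr_gt0.
have qE : (1 - v * delta) * decay_rate = 1 - v.
  by rewrite /decay_rate mulrC divfK ?gt_eqF.
rewrite -(ler_pM2l vd0) [X in _ <= X]mulrDr [X in _ <= X + _]mulrA qE.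
have AS : 0 <= A * S ^+ t.+1 by rewrite mulr_ge0// exprn_ge0// ltW.
have : 2^-1 * (2 * A * S ^+ t.+1) <= (1 - v * delta) * (2 * A * S ^+ t.+1).
  by rewrite ler_wpM2r// -mulrA mulr_ge0.
by move: H D E; lra.
Qed.

Lemma decay_rate_ge : 1 - v <= decay_rate.
Proof.
case/andP: v01 => v0 _.
rewrite /decay_rate ler_pdivlMr; last by apply: lt_le_trans vd; rewrite invr_gt0.
by rewrite ler_piMr ?(ltW v1)// gerBl mulr_ge0// ltW.
Qed.

(** When the recursion is unrolled, the error made at time [s] is at most
    [2 A (rho * decay_rate)^s], since [S <= rho (1 - v) <= rho * decay_rate]; relative to
    [decay_rate^s] the errors form a geometric series in [rho]. *)
Lemma survival_le t : h t <= (1 + 2 * A / (1 - rho)) * decay_rate ^+ t.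
Proof.
case/andP: rho01 => r0 rlt1; case/andP: S01 => s0 _.
have q0 : 0 < decay_rate by apply: lt_le_trans decay_rate_ge.
suff H : h t <= (1 + 2 * A * \sum_(0 <= s < t) rho ^+ s.+1) * decay_rate ^+ t.
  apply: le_trans H _; rewrite ler_wpM2r ?exprn_ge0 ?(ltW q0)// lerD2l.
  rewrite ler_wpM2l ?mulr_ge0//; apply: le_trans (geometric_sum_le t.+1 _); last by rewrite (ltW r0).
  by rewrite [X in _ <= X]big_nat_recl// ler_wpDl ?expr0.
elim: t => [|t IH]; first by rewrite survival0 big_geq// mulr0 addr0 expr0 mulr1.
apply: le_trans (survival_step t) _; rewrite big_nat_recr//= [X in _ <= (_ + X) * _]mulrDr addrA [X in _ <= X]mulrDl lerD//.
  by rewrite exprS mulrCA ler_wpM2l// ltW.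
rewrite -[X in _ <= X]mulrA ler_wpM2l ?mulr_ge0// -exprMn lerXn2r ?nnegrE ?(mulr_ge0 (ltW r0) (ltW q0)) ?(ltW s0)//.
by apply: le_trans S_rho _; rewrite ler_wpM2l ?(ltW r0)// decay_rate_ge.
Qed.

End SharpUpper.

(** Abel summation, with [f t.+1 = h t - h t.+1]. *)
Lemma survival_exp_moment x N :
  \sum_(0 <= t < N.+1) f t * x ^+ t =
  1 - h N * x ^+ N + (x - 1) * \sum_(0 <= t < N) h t * x ^+ t.
Proof.
elim: N => [|N IH].
  by rewrite big_nat1 f0 big_geq// survival0 expr0; ring.
by rewrite big_nat_recr//= IH big_nat_recr//= -survivalS -/h exprS; ring.
Qed.

(* Multiply [renewal_survival] by th^t with th slightly above 1 and sum: then
   (v - D (th - 1)) sum_t h t th^t is bounded. *)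
Lemma survival_geometric : exists C x, 0 <= C /\ 0 < x < 1 /\ forall t, h t <= C * x ^+ t.
Proof.
case/andP: S01 => s0 s1; case/andP: v01 => v0 v1.
(* [D] will bound the sum of [d t * th ^+ t]: the term at [0] is at most [1], the rest is dominated
   by a geometric series. *)
pose rho := (1 + S) / 2; pose D := 1 + A / (1 - rho).
have rho1 : rho < 1 by rewrite /rho; lra.
have rhoS : S < rho by rewrite /rho; lra.
have r0 : 0 < rho by apply: lt_trans rhoS.
have r1 : 0 < 1 - rho by rewrite subr_gt0.
have AD : 0 <= A / (1 - rho) by rewrite divr_ge0// ltW.
have D0 : 0 < D by rewrite /D; lra.
(* The first bound keeps [S * th <= rho], so that [d] and [e] stay summable; the second gives
   [D * (th - 1) <= v / 2], so that [H N] can be absorbed on the left. *)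
pose th := Num.min (rho / S) (1 + v / (2 * D)).
have th1 : 1 < th by rewrite lt_min ltr_pdivlMr// mul1r rhoS/= ltrDl divr_gt0// mulr_gt0.
have th0 : 0 < th by apply: lt_trans th1.
have thS : S * th <= rho by rewrite mulrC -ler_pdivlMr// ge_min lexx.
have thD : D * (th - 1) <= v / 2.
  have : th <= 1 + v / (2 * D) by rewrite ge_min lexx orbT.
  rewrite -lerBlDl -(ler_pM2l D0) => /le_trans; apply.
  by rewrite le_eqVlt; apply/orP; left; apply/eqP; field; rewrite gt_eqF.
have geo N (g : nat -> R) : (forall t, g t <= A * S ^+ t) ->
    \sum_(0 <= t < N) g t * th ^+ t <= A / (1 - rho).
  move=> gA; apply: (@le_trans _ _ (A * \sum_(0 <= t < N) rho ^+ t)).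
    rewrite mulr_sumr; apply: ler_sum => t _.
    apply: (@le_trans _ _ (A * S ^+ t * th ^+ t)).
      by rewrite ler_wpM2r ?exprn_ge0 ?(ltW th0).
    by rewrite -mulrA -exprMn ler_wpM2l// lerXn2r ?nnegrE ?(mulr_ge0 (ltW s0) (ltW th0)) ?(ltW r0).
  by rewrite ler_wpM2l// geometric_sum_le// (ltW r0).
have dD N : \sum_(0 <= t < N) d t * th ^+ t <= D.
  case: N => [|N]; first by rewrite big_geq// ltW.
  rewrite big_nat_recl// d0 expr0 mulr1; apply: lerD; first by rewrite gerBl ltW.
  have -> : \sum_(0 <= t < N) d t.+1 * th ^+ t.+1 =
      \sum_(0 <= t < N.+1) (if t is t'.+1 then d t else 0) * th ^+ t.
    by rewrite [RHS]big_nat_recl// mul0r add0r.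
  apply: geo => -[|t]; first by rewrite expr0 mulr1.
  by case/andP: (dS t).
pose H N := \sum_(0 <= t < N.+1) h t * th ^+ t.
have HN N : v * H N <= D + D * (1 + (th - 1) * H N).
  have -> : v * H N = \sum_(0 <= t < N.+1) e t * th ^+ t +
      \sum_(0 <= t < N.+1) \sum_(0 <= s < t.+1)
        (f s * th ^+ s) * (d (t - s)%N * th ^+ (t - s)).
    rewrite -big_split /= /H mulr_sumr; apply: eq_bigr => t _.
    have -> : \sum_(0 <= s < t.+1) (f s * th ^+ s) * (d (t - s)%N * th ^+ (t - s)) =
        (v * h t - e t) * th ^+ t.
      rewrite -renewal_survival mulr_suml; apply: eq_big_nat => s /andP[_ st].
      by rewrite -[in th ^+ t](subnKC (_ : s <= t)%N)// exprD; ring.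
    by ring.
  rewrite (sum_convolution (fun s => f s * th ^+ s) (fun m => d m * th ^+ m)).
  apply: lerD.
    apply: le_trans (_ : A / (1 - rho) <= _); last by rewrite lerDr.
    by apply: geo => t; case/andP: (e_bounds t).
  apply: (@le_trans _ _ (D * \sum_(0 <= s < N.+1) f s * th ^+ s)).
    rewrite mulr_sumr; apply: ler_sum => s _; rewrite mulrC ler_wpM2r//.
    by rewrite mulr_ge0// exprn_ge0// ltW.
  rewrite ler_wpM2l ?(ltW D0)// survival_exp_moment /H big_nat_recr//= mulrDr.
  have hN : 0 <= h N * th ^+ N by rewrite mulr_ge0 ?survival_ge0 ?exprn_ge0 ?ltW.
  by have : 0 <= (th - 1) * (h N * th ^+ N); [rewrite mulr_ge0// subr_ge0 ltW|lra].
have H0 N : 0 <= H N by apply: sumr_ge0 => t _; rewrite mulr_ge0 ?survival_ge0 ?exprn_ge0 ?ltW.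
(* From [v H <= 2 D + (v / 2) H]. *)
have HC N : H N <= 4 * D / v.
  rewrite ler_pdivlMr//.
  have : D * (th - 1) * H N <= v / 2 * H N by rewrite ler_wpM2r.
  by move: (HN N); move: (H N) => y; lra.
exists (4 * D / v), th^-1; split; first by rewrite !mulr_ge0 ?invr_ge0 ?ltW.
split; first by rewrite invr_gt0 th0 invf_lt1.
move=> t; rewrite exprVn ler_pdivlMr ?exprn_gt0//; apply: le_trans (HC t).
rewrite /H big_nat_recr//= lerDr; apply: sumr_ge0 => s _.
by rewrite mulr_ge0 ?survival_ge0 ?exprn_ge0 ?ltW.
Qed.

End RenewalTail.

(** * Moments *)

Section RisingMoments.
Variable R : realType.
Implicit Types (f h : nat -> R) (p q : R) (r t N : nat).

(* Rising factorials: for the geometric tail p^t the r-th rising moment is exactly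
   r! (1-p)^-r, so tail bounds transfer to moments without loss. *)
Definition rising r t : R := \prod_(0 <= i < r) (t + i)%:R.

Lemma rising0 t : rising 0 t = 1.
Proof. exact: big_geq. Qed.

Lemma risingSl r t : rising r.+1 t = t%:R * rising r t.+1.
Proof.
rewrite /rising big_nat_recl//= addn0; congr (_ * _).
by apply: eq_bigr => i _; rewrite addnS.
Qed.

Lemma risingSr r t : rising r.+1 t = rising r t * (t + r)%:R.
Proof. by rewrite /rising big_nat_recr. Qed.

Lemma rising_ge0 r t : 0 <= rising r t.
Proof. by apply: prodr_ge0. Qed.

Lemma rising_leS r t : rising r t <= rising r t.+1.
Proof. by apply: ler_prod => i _; rewrite ler0n ler_nat addSn leqnSn. Qed.

Lemma expn_le_rising r t : t%:R ^+ r <= rising r t.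
Proof.
elim: r => [|r IH]; first by rewrite expr0 rising0.
by rewrite exprSr risingSr ler_pM ?exprn_ge0// ler_nat leq_addr.
Qed.

(** The triangular number [r (r + 1) / 2], the coefficient of [t^r] in [rising r.+1 t]. *)
Definition rising_defect r : R := \sum_(0 <= i < r) i.+1%:R.

(** With [expn_le_rising], this replaces power moments by rising ones at the cost of a moment of
    lower order, negligible after scaling. *)
Lemma rising_le_expn r t : rising r.+1 t <= t%:R ^+ r.+1 + rising_defect r * rising r t.
Proof.
elim: r => [|r IH].
  by rewrite /rising_defect big_geq// mul0r addr0 risingSr rising0 addn0 mul1r expr1.
rewrite risingSr natrD -addn1 natrD mulrDr -natrD addn1 [rising_defect _]big_nat_recr//=.
rewrite mulrDl addrA lerD//; last by rewrite mulrC.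
apply: le_trans (_ : (t%:R ^+ r.+1 + rising_defect r * rising r t) * t%:R <= _).
  by rewrite ler_wpM2r.
rewrite mulrDl -exprSr lerD2l -mulrA ler_wpM2l ?sumr_ge0//.
by rewrite risingSr ler_wpM2l ?rising_ge0// ler_nat leq_addr.
Qed.

Lemma rising_diff r t : rising r.+1 t.+1 - rising r.+1 t = r.+1%:R * rising r t.+1.
Proof. by rewrite risingSr risingSl addSnnS natrD; ring. Qed.

(** Abel summation with [rising_diff] as discrete derivative: for [h] a tail, it turns rising
    moments of the law into sums over the tail. *)
Lemma rising_by_parts h r N :
  \sum_(0 <= t < N) rising r.+1 t.+1 * (h t - h t.+1) =
  r.+1%:R * (\sum_(0 <= t < N) rising r t.+1 * h t) - rising r.+1 N * h N.
Proof.
elim: N => [|N IH]; first by rewrite !big_geq// risingSl; ring.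
have -> : rising r.+1 N.+1 = rising r.+1 N + r.+1%:R * rising r N.+1.
  by rewrite -rising_diff addrC subrK.
by rewrite !big_nat_recr//= IH -[rising r.+1 N.+1](subrK (rising r.+1 N)) rising_diff; ring.
Qed.

Section Geometric.
Variable p : R.
Hypothesis p01 : 0 < p < 1.
Let p0 : 0 < p. Proof. by case/andP: p01. Qed.
Let p1 : 0 < 1 - p. Proof. by rewrite subr_gt0; case/andP: p01. Qed.

Lemma rising_geometric_parts r N :
  (1 - p) * \sum_(0 <= t < N) rising r.+1 t.+1 * p ^+ t =
  r.+1%:R * (\sum_(0 <= t < N) rising r t.+1 * p ^+ t) - rising r.+1 N * p ^+ N.
Proof.
rewrite -rising_by_parts mulr_sumr; apply: eq_bigr => t _.
by rewrite exprS; ring.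
Qed.

Lemma rising_geometric_le r N :
  \sum_(0 <= t < N) rising r t.+1 * p ^+ t <= r`!%:R * (1 - p) ^- r.+1.
Proof.
elim: r N => [|r IH] N.
  rewrite mul1r expr1 (eq_bigr (fun t => p ^+ t)).
    by rewrite geometric_sum_le// ltW//; case/andP: p01.
  by move=> t _; rewrite rising0 mul1r.
rewrite -(ler_pM2l p1) rising_geometric_parts.
apply: le_trans (_ : r.+1%:R * (r`!%:R * (1 - p) ^- r.+1) <= _).
  rewrite lerBlDr ler_wpDr ?mulr_ge0 ?rising_ge0 ?exprn_ge0 ?(ltW p0)//.
  by rewrite ler_wpM2l.
rewrite factS natrM [(1 - p) ^+ r.+2]exprS invfM le_eqVlt; apply/orP; left; apply/eqP.
by field; rewrite expf_neq0 ?gt_eqF.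
Qed.

Lemma cvg_rising_geometric0 r : (fun t => rising r t * p ^+ t) @ \oo --> (0 : R).
Proof.
have t0 t : 0 <= rising r t.+1 * p ^+ t by rewrite mulr_ge0 ?rising_ge0 ?exprn_ge0 ?(ltW p0).
have h0 : (fun t => rising r t.+1 * p ^+ t) @ \oo --> (0 : R).
  apply: cvg_series_cvg_0; apply: nondecreasing_is_cvgn.
    by apply: nondecreasing_series => k _ _; apply: t0.
  by exists (r`!%:R * (1 - p) ^- r.+1) => _ [N _ <-]; apply: rising_geometric_le.
apply: squeeze_cvgr h0; last exact: cvg_cst.
near=> t; rewrite mulr_ge0 ?rising_ge0 ?exprn_ge0 ?(ltW p0)//=.
by rewrite ler_wpM2r ?exprn_ge0 ?(ltW p0)// rising_leS.
Unshelve. all: by end_near. Qed.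

(** The negative binomial series, since [rising r t.+1 = r! 'C(t + r, r)]; by parts, each order
    follows from the previous one. *)
Lemma cvg_rising_geometric r :
  (fun N => \sum_(0 <= t < N) rising r t.+1 * p ^+ t) @ \oo --> (r`!%:R * (1 - p) ^- r.+1 : R).
Proof.
elim: r => [|r IH].
  have -> : (fun N => \sum_(0 <= t < N) rising 0 t.+1 * p ^+ t) =
            (fun N => (1 - rising 0 N * p ^+ N) / (1 - p)).
    apply/funext => N; apply: (mulIf (lt0r_neq0 p1)); rewrite divfK ?gt_eqF//.
    elim: N => [|N IH]; first by rewrite big_geq// rising0 expr0; ring.
    by rewrite big_nat_recr//= mulrDl IH !rising0 exprS; ring.
  rewrite fact0 mul1r expr1 -[X in _ --> X]mul1r; apply: cvgMl.
  rewrite -[X in _ --> X]subr0; apply: cvgB; [exact: cvg_cst|exact: cvg_rising_geometric0].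
have -> : (fun N => \sum_(0 <= t < N) rising r.+1 t.+1 * p ^+ t) =
   (fun N => (r.+1%:R * (\sum_(0 <= t < N) rising r t.+1 * p ^+ t) - rising r.+1 N * p ^+ N) / (1 - p)).
  by apply/funext => N; rewrite -rising_geometric_parts mulrAC divff ?mul1r// gt_eqF.
have -> : (r.+1)`!%:R * (1 - p) ^- r.+2 = (r.+1%:R * (r`!%:R * (1 - p) ^- r.+1) - 0) / (1 - p).
  by rewrite factS natrM [(1 - p) ^+ r.+2]exprSr invfM subr0 !mulrA.
by apply: cvgMl; apply: cvgB; [exact: cvgMr|exact: cvg_rising_geometric0].
Qed.

End Geometric.

Lemma nneseries_bounded (u : nat -> R) (B : R) : (forall t, 0 <= u t) ->
  (forall N, \sum_(0 <= t < N) u t <= B) ->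
  exists L, [/\ (\sum_(0 <= t <oo) (u t)%:E = L%:E)%E,
    (fun N => \sum_(0 <= t < N) u t) @ \oo --> L & L <= B].
Proof.
move=> u0 uB.
have cu : cvgn (series u).
  apply: nondecreasing_is_cvgn; first by apply: nondecreasing_series => k _ _; apply: u0.
  by exists B => _ [N _ <-]; apply: uB.
exists (limn (series u)); split => //.
  apply: cvg_lim => //.
  under eq_fun do rewrite sumEFin.
  by apply: cvg_EFin => //; near=> n.
by apply: limr_le => //; near=> N; apply: uB.
Unshelve. all: by end_near. Qed.

Section Moments.
Variables (f : nat -> R) (C q v : R).
Hypotheses (f0 : f 0%N = 0) (f_ge0 : forall t, 0 <= f t).
Hypotheses (q01 : 0 < q < 1) (C1 : 1 <= C).
Let h := survival f.
Hypothesis (h_ge0 : forall t, 0 <= h t) (h_le : forall t, h t <= C * q ^+ t).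

Let C0 : 0 <= C. Proof. exact: le_trans C1. Qed.
Let q1 : 0 < 1 - q. Proof. by rewrite subr_gt0; case/andP: q01. Qed.

Lemma sum_le1 N : \sum_(0 <= t < N) f t.+1 <= 1.
Proof.
have := h_ge0 N; rewrite /h /survival subr_ge0.
by rewrite big_nat_recl// f0 add0r.
Qed.

Lemma rising_moment_le r N :
  \sum_(0 <= t < N) rising r t.+1 * f t.+1 <= C * (r`!%:R * (1 - q) ^- r).
Proof.
case: r => [|r].
  (* At order [0] there is no summation by parts; total mass at most one and [1 <= C] suffice. *)
  rewrite expr0 invr1 !mulr1 (eq_bigr (fun t => f t.+1)); first exact: le_trans (sum_le1 N) C1.
  by move=> t _; rewrite rising0 mul1r.
under eq_bigr do rewrite -(survivalS f).
rewrite (rising_by_parts (survival f)).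
apply: le_trans (_ : r.+1%:R * (C * (r`!%:R * (1 - q) ^- r.+1)) <= _); last first.
  by rewrite factS natrM le_eqVlt; apply/orP; left; apply/eqP; ring.
rewrite lerBlDr ler_wpDr ?mulr_ge0 ?rising_ge0//.
rewrite ler_wpM2l//; apply: le_trans (_ : C * \sum_(0 <= t < N) rising r t.+1 * q ^+ t <= _).
  rewrite mulr_sumr; apply: ler_sum => t _.
  by rewrite mulrCA ler_wpM2l ?rising_ge0//; apply: h_le.
by rewrite ler_wpM2l// rising_geometric_le.
Qed.

Lemma sum_expn_shift r N :
  \sum_(0 <= t < N.+1) t%:R ^+ r * f t = \sum_(0 <= t < N) t.+1%:R ^+ r * f t.+1.
Proof. by rewrite big_nat_recl// f0 mulr0 add0r. Qed.

Lemma expn_moment_le r N :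
  \sum_(0 <= t < N) t%:R ^+ r * f t <= C * (r`!%:R * (1 - q) ^- r).
Proof.
case: N => [|N].
  by rewrite big_geq// !mulr_ge0// invr_ge0 exprn_ge0// ltW.
rewrite sum_expn_shift; apply: le_trans (rising_moment_le r N).
by apply: ler_sum => t _; rewrite ler_wpM2r ?expn_le_rising.
Qed.

Hypotheses (v01 : 0 < v < 1) (h_ge : forall t, (1 - v) ^+ t <= h t).

(** Upper bound: powers are at most rising factorials and [h <= C q^t]. Lower bound:
    [rising_le_expn], with [h >= (1 - v)^t] in the leading term and the upper bound in the
    correction. *)
Lemma moment_bounds r : exists L,
  (\sum_(0 <= t <oo) (t%:R ^+ r.+1 * f t)%:E = L%:E)%E /\
  (r.+1)`!%:R * v ^- r.+1 - rising_defect r * (C * (r`!%:R * (1 - q) ^- r)) <= L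
    <= C * ((r.+1)`!%:R * (1 - q) ^- r.+1).
Proof.
have u0 t : 0 <= t%:R ^+ r.+1 * f t by rewrite mulr_ge0 ?exprn_ge0.
have [L [LE Lcvg LB]] := nneseries_bounded u0 (@expn_moment_le r.+1).
exists L; split=> //; rewrite LB andbT.
set K := rising_defect r * _.
(* Partial sums of the lower bound; the middle term dominates the boundary term of the summation by
   parts and tends to [0]. *)
pose Y N := r.+1%:R * (\sum_(0 <= t < N) rising r t.+1 * (1 - v) ^+ t)
   - C * (rising r.+1 N * q ^+ N) - K.
have Ycvg : Y @ \oo --> ((r.+1)`!%:R * v ^- r.+1 - K).
  have -> : (r.+1)`!%:R * v ^- r.+1 - K = r.+1%:R * (r`!%:R * (1 - (1 - v)) ^- r.+1) - C * 0 - K.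
    by rewrite factS natrM mulr0 subr0 subKr mulrA.
  apply: cvgB; last exact: cvg_cst.
  apply: cvgB; apply: cvgMr.
    by apply: cvg_rising_geometric; case/andP: v01 => ? ?; rewrite subr_gt0 gtrBl; apply/andP.
  exact: cvg_rising_geometric0.
apply: (@ler_cvg_to _ _ _ _ Y (fun N => \sum_(0 <= t < N.+1) t%:R ^+ r.+1 * f t) _ _ Ycvg).
  by rewrite (cvg_shiftS (fun N => \sum_(0 <= t < N) t%:R ^+ r.+1 * f t)).
near=> N; rewrite sum_expn_shift.
apply: le_trans (_ : \sum_(0 <= t < N) rising r.+1 t.+1 * f t.+1
   - rising_defect r * \sum_(0 <= t < N) rising r t.+1 * f t.+1 <= _).
  rewrite /Y; apply: lerB; last first.
    by rewrite /K ler_wpM2l ?rising_moment_le// sumr_ge0.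
  under [in X in _ <= X]eq_bigr do rewrite -(survivalS f).
  rewrite (rising_by_parts (survival f)); apply: lerB.
    rewrite ler_wpM2l//; apply: ler_sum => t _; rewrite ler_wpM2l ?rising_ge0//; exact: h_ge.
  by rewrite mulrCA ler_wpM2l ?rising_ge0//; exact: h_le.
rewrite mulr_sumr -sumrB; apply: ler_sum => t _.
rewrite mulrA -mulrBl ler_wpM2r// lerBlDr; exact: rising_le_expn.
Unshelve. all: by end_near. Qed.

End Moments.
End RisingMoments.

(** * Limits *)

Section Limits.
Variable R : realType.
Implicit Types (a : nat -> R) (k : nat -> nat).

Lemma cvgrX (T : Type) (F : set_system T) (FF : Filter F) (g : T -> R) (l : R) r :
  g @ F --> l -> (fun x => g x ^+ r) @ F --> l ^+ r.
Proof.
move=> gl; elim: r => [|r IH]; first by under eq_fun do rewrite expr0; exact: cvg_cst.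
by under eq_fun do rewrite exprS; rewrite exprS; apply: cvgM.
Qed.

(** The lower bound is [1 / (1 - x) = 1 + x / (1 - x) <= expR (x / (1 - x))], inverted. *)
Lemma onem_expR_bounds (x : R) : 0 <= x < 1 ->
  expR (- (x / (1 - x))) <= 1 - x <= expR (- x).
Proof.
case/andP=> x0 x1; have x1' : 0 < 1 - x by rewrite subr_gt0.
rewrite expR_ge1Dx andbT expRN -[X in _ <= X]invrK lef_pV2 ?posrE ?invr_gt0 ?expR_gt0//.
apply: le_trans (expR_ge1Dx _); rewrite le_eqVlt; apply/orP; left; apply/eqP.
by field; rewrite gt_eqF.
Qed.

Lemma cvg_onem_pow a k (x : R) : a @ \oo --> (0 : R) ->
  (\forall n \near \oo, 0 <= a n) ->
  (fun n => a n * (k n)%:R) @ \oo --> x ->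
  (fun n => (1 - a n) ^+ k n) @ \oo --> expR (- x).
Proof.
move=> a0 age0 akx.
have lt1 : \forall n \near \oo, a n < 1 by apply: (cvgr_lt _ a0).
have E : forall u (y : R), u @ \oo --> y -> (fun n => expR (- u n)) @ \oo --> expR (- y).
  move=> u y uy; apply: (continuous_cvg _ (@continuous_expR R (- y))).
  exact: cvgN.
apply: (@squeeze_cvgr _ _ _ _ (fun n => expR (- (a n * (k n)%:R / (1 - a n))))
   (fun n => expR (- (a n * (k n)%:R)))).
- near=> n.
  have n01 : 0 <= a n < 1 by apply/andP; split; near: n.
  have /andP[h1 h2] := onem_expR_bounds n01.
  have p1 : 0 <= 1 - a n by rewrite subr_ge0 ltW//; case/andP: n01.
  have -> : - (a n * (k n)%:R / (1 - a n)) = (k n)%:R * (- (a n / (1 - a n))) by ring.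
  have -> : - (a n * (k n)%:R) = (k n)%:R * (- a n) by ring.
  by rewrite !expRM_natl !lerXn2r ?nnegrE ?expR_ge0.
- apply: E; rewrite -[x]divr1; apply: cvgM => //.
  apply: cvgV; first by rewrite oner_neq0.
  by rewrite -[X in _ --> X]subr0; apply: cvgB => //; exact: cvg_cst.
- exact: E.
Unshelve. all: by end_near. Qed.

End Limits.

(** * The infinite product [(S;S)_oo] and its perturbation *)

Section QPochhammer.
Variables (R : realType) (S : R).
Hypothesis S01 : 0 < S < 1.
Let s0 : 0 < S. Proof. by case/andP: S01. Qed.
Let s1 : S < 1. Proof. by case/andP: S01. Qed.
Let s1' : 0 < 1 - S. Proof. by rewrite subr_gt0. Qed.

Let Sr_le r : S ^+ r.+1 <= S.
Proof. by rewrite exprS ler_piMr ?(ltW s0)// exprn_ile1 ?ltW. Qed.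

Let Sr_lt1 r : S ^+ r.+1 < 1. Proof. exact: le_lt_trans (Sr_le r) s1. Qed.

Let qprod m := \prod_(1 <= r < m.+1) (1 - S ^+ r).

Let qprodE m : qprod m = \prod_(0 <= r < m) (1 - S ^+ r.+1).
Proof. by rewrite /qprod big_add1. Qed.

(** Each factor is at least [expR (- S^(r+1) / (1 - S))] because [1 - S^(r+1) >= 1 - S], and the
    powers of [S] sum to at most [1 / (1 - S)]. A bound independent of [m] makes the limit
    positive. *)
Lemma qprod_ge m : expR (- (1 - S) ^- 2) <= \prod_(0 <= r < m) (1 - S ^+ r.+1).
Proof.
apply: le_trans (_ : expR (\sum_(0 <= r < m) - (S ^+ r.+1 / (1 - S))) <= _).
  rewrite ler_expR sumrN lerN2 -mulr_suml expr2 invfM ler_wpM2r ?invr_ge0 ?(ltW s1')//.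
  apply: le_trans (geometric_sum_le m _); last by rewrite (ltW s0).
  by apply: ler_sum => r _; rewrite exprS ler_piMl ?exprn_ge0 ?ltW.
rewrite expR_sum; apply: ler_prod => r _; rewrite expR_ge0/=.
have x01 : 0 <= S ^+ r.+1 < 1 by rewrite exprn_ge0 ?(ltW s0)//=.
have /andP[+ _] := onem_expR_bounds x01; apply: le_trans.
rewrite ler_expR lerN2 ler_wpM2l ?exprn_ge0 ?(ltW s0)// lef_pV2 ?posrE ?subr_gt0//.
by rewrite lerD2l lerN2.
Qed.

Lemma cvg_qprod : (fun m => \prod_(0 <= r < m) (1 - S ^+ r.+1)) @ \oo --> qpoch S.
Proof.
have -> : (fun m => \prod_(0 <= r < m) (1 - S ^+ r.+1)) = qprod.
  by apply/funext => m; rewrite qprodE.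
apply: nonincreasing_is_cvgn; last first.
  by exists (expR (- (1 - S) ^- 2)) => _ [m _ <-]; rewrite qprodE qprod_ge.
apply/nonincreasing_seqP => m; rewrite !qprodE big_nat_recr//= ler_piMr//.
  by apply: prodr_ge0 => r _; rewrite subr_ge0 ltW.
by rewrite gerBl exprn_ge0 ?ltW.
Qed.

Lemma qpoch_gt0 : 0 < qpoch S.
Proof.
apply: lt_le_trans (expR_gt0 (- (1 - S) ^- 2)) _.
rewrite -(cvg_lim _ cvg_qprod)//; apply: limr_ge; first exact: (cvgP _ cvg_qprod).
by near=> m; exact: qprod_ge.
Unshelve. all: by end_near. Qed.

(* The extra term S^r r/n in the r-th factor costs at most a ratio
   exp (r S^r / (n (1 - S))), and the series of the r S^r converges. *)
Lemma cvg_qprod_perturbed :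
  (fun n => \prod_(0 <= r < n) (1 - S ^+ r.+1 * (1 - r.+1%:R / n%:R))) @ \oo --> qpoch S.
Proof.
(* [(1 - S) ^- 2] bounds the sum of [(r + 1) S^(r+1)]; the other [1 / (1 - S)] comes from dividing
   by a factor [1 - S^(r+1) >= 1 - S]. *)
pose c := (1 - S) ^- 2 / (1 - S).
apply: (@squeeze_cvgr _ _ _ _ (fun n => \prod_(0 <= r < n) (1 - S ^+ r.+1))
  (fun n => (\prod_(0 <= r < n) (1 - S ^+ r.+1)) * expR (c / n%:R))).
- near=> n.
  have n0 : 0 < (n%:R : R) by rewrite ltr0n; near: n; exact: nbhs_infty_gt.
  apply/andP; split.
    apply: ler_prod => r _; rewrite subr_ge0 ltW//= lerD2l lerN2.
    by rewrite ler_piMr ?exprn_ge0 ?(ltW s0)// gerBl divr_ge0 ?ltW.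
  apply: le_trans (_ : \prod_(0 <= r < n) ((1 - S ^+ r.+1) *
      expR (r.+1%:R * S ^+ r.+1 / (n%:R * (1 - S)))) <= _).
    rewrite [X in X <= _]big_nat [X in _ <= X]big_nat.
    apply: ler_prod => r /andP[_ rn]; apply/andP; split.
        rewrite subr_ge0 mulr_ile1 ?exprn_ge0 ?(ltW s0) ?(ltW (Sr_lt1 _))//.
      by rewrite subr_ge0 ler_pdivrMr// mul1r ler_nat.
    have y0 : 0 < 1 - S ^+ r.+1 by rewrite subr_gt0.
    apply: le_trans (ler_wpM2l (ltW y0) (expR_ge1Dx _)).
    rewrite [X in _ <= X]mulrDr mulr1.
    have -> : (1 - S ^+ r.+1) * (r.+1%:R * S ^+ r.+1 / (n%:R * (1 - S))) =
       S ^+ r.+1 * (r.+1%:R / n%:R) * ((1 - S ^+ r.+1) / (1 - S)).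
      by field; rewrite !gt_eqF.
    rewrite [S ^+ r.+1 * (1 - _)]mulrBr mulr1 opprB [X in X <= _]addrCA addrC lerD2l.
    rewrite ler_peMr ?mulr_ge0 ?exprn_ge0 ?invr_ge0 ?(ltW s0) ?(ltW n0)//.
    by rewrite ler_pdivlMr// mul1r lerD2l lerN2.
  rewrite big_split /= -expR_sum ler_wpM2l//.
    by apply: prodr_ge0 => r _; rewrite subr_ge0 ltW.
  rewrite ler_expR -mulr_suml invfM [X in _ <= X]mulrAC [X in X <= _]mulrCA [X in X <= _]mulrC.
  rewrite /c -mulrA [X in _ <= _ * X]mulrC mulrA.
  rewrite !ler_wpM2r ?invr_ge0 ?(ltW n0) ?(ltW s1')//.
  have := rising_geometric_le S01 1 n; rewrite mul1r; apply: le_trans.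
  apply: ler_sum => r _; rewrite risingSl rising0 mulr1 exprS mulrCA ler_piMl ?mulr_ge0 ?exprn_ge0 ?ltW//.
- exact: cvg_qprod.
- have cn : (fun n => c / n%:R) @ \oo --> (0 : R).
    have H : (fun n : nat => n%:R^-1) @ \oo --> (0 : R).
      by rewrite -cvg_shiftS; exact: cvg_harmonic.
    by rewrite -(mulr0 c); apply: cvgMr.
  rewrite -[X in _ --> X]mulr1; apply: cvgM; first exact: cvg_qprod.
  by have := continuous_cvg _ (@continuous_expR R 0) cn; rewrite expR0; apply.
Unshelve. all: by end_near. Qed.

End QPochhammer.

(** * Asymptotics of [mu], of the moments and of the distribution function *)

Section CollectorAsymptotics.
Variables (R : realType) (alpha beta : R).
Hypotheses (ha0 : 0 <= alpha) (ha1 : alpha < 1) (hb0 : 0 < beta) (hb1 : beta < 1).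
Variable nu : nat -> nat -> R.
Hypothesis hnu : forall n, (0 < n)%N -> stationary alpha beta n (nu n).
Let Q := 1 - alpha.
Let S := 1 - beta.
Let m n := mu alpha beta n (nu n).
Let v n := nu n n.
Let f n := pT alpha beta n.
(** Strictly between [S] and [1], so that [S <= rho * (1 - v n)] once [v n] is small. *)
Let rho := (1 + S) / 2.
Let A n := S ^+ n.-1.
Let delta n := A n / ((1 - v n) * (1 - rho)).
Let q n := decay_rate (v n) (A n) rho.
Let C n := 1 + 2 * A n / (1 - rho).

Let S01 : 0 < S < 1. Proof. by rewrite /S subr_gt0 hb1/= gtrBl. Qed.
Let s0 : 0 < S. Proof. by case/andP: S01. Qed.
Let s1 : S < 1. Proof. by case/andP: S01. Qed.
Let Q01 : 0 < Q <= 1. Proof. by rewrite /Q subr_gt0 ha1/= gerBl. Qed.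
Let rho01 : 0 < rho < 1. Proof. by move: s0 s1; rewrite /rho; lra. Qed.
Let rho1 : 0 < 1 - rho. Proof. by rewrite subr_gt0; case/andP: rho01. Qed.
Let A_ge0 n : 0 <= A n. Proof. by rewrite exprn_ge0// ltW. Qed.
Let C_ge1 n : 1 <= C n. Proof. by rewrite /C lerDl divr_ge0 ?mulr_ge0// ltW. Qed.

Let v01 n : (0 < n)%N -> 0 < v n < 1.
Proof.
move=> n0; rewrite /v (stationary_top_gt0 ha0 ha1 hb0 hb1 n0 (hnu n0))/=.
apply: le_lt_trans (stationary_top_le ha0 ha1 hb0 hb1 n0 (hnu n0)) _.
by rewrite exprn_ilt1 ?(ltW s0)// -lt0n.
Qed.

Let QS n : (0 < n)%N -> 0 < 1 - Q * S ^+ n.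
Proof.
move=> n0; case/andP: Q01 => q0 q1; rewrite subr_gt0.
apply: le_lt_trans (_ : S ^+ n < 1); last by rewrite exprn_ilt1 ?(ltW s0)// -lt0n.
by rewrite ler_piMl ?exprn_ge0 ?(ltW s0).
Qed.

Lemma mu_gt0 n : (0 < n)%N -> 0 < m n.
Proof.
move=> n0; rewrite /m mu_stationary//; last exact: hnu.
by rewrite mulr_gt0 ?QS//; case/andP: (v01 n0).
Qed.

Let f_ge0 n t : 0 <= f n t. Proof. exact: pT_ge0. Qed.

Lemma collector_survival_ge n t : (0 < n)%N -> (1 - v n) ^+ t <= survival (f n) t.
Proof.
move=> n0; apply: (survival_ge (v01 n0) erefl (f_ge0 n) (return_gap0 alpha beta n (nu n))
  (return_gap_bounds ha0 ha1 hb0 hb1 n0 (hnu n0))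
  (stat_gap_bounds ha0 ha1 hb0 hb1 n0 (hnu n0))
  (renewal_top alpha beta (nu n) n0)).
Qed.

Lemma collector_survival_ge0 n t : (0 < n)%N -> 0 <= survival (f n) t.
Proof.
move=> n0; apply: le_trans (collector_survival_ge t n0).
by rewrite exprn_ge0// subr_ge0 ltW//; case/andP: (v01 n0).
Qed.

(** Serves finiteness of the moments for every [n > 0]; the sharp bound is available only for
    [large n]. *)
Lemma collector_survival_geometric n : (0 < n)%N ->
  exists c x, 0 <= c /\ 0 < x < 1 /\ forall t, survival (f n) t <= c * x ^+ t.
Proof.
move=> n0; exact: (survival_geometric S01 (v01 n0) (A_ge0 n)
  erefl (f_ge0 n) (return_gap0 alpha beta n (nu n))
  (return_gap_bounds ha0 ha1 hb0 hb1 n0 (hnu n0))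
  (stat_gap_bounds ha0 ha1 hb0 hb1 n0 (hnu n0))
  (renewal_top alpha beta (nu n) n0)).
Qed.

Let large n := [/\ (0 < n)%N, S <= rho * (1 - v n) & delta n <= 2^-1].

Lemma collector_survival_le n t : large n -> survival (f n) t <= C n * q n ^+ t.
Proof.
case=> n0 h1 h2; exact: (survival_le S01 (v01 n0) (A_ge0 n)
  erefl (f_ge0 n) (return_gap0 alpha beta n (nu n))
  (return_gap_bounds ha0 ha1 hb0 hb1 n0 (hnu n0))
  (stat_gap_bounds ha0 ha1 hb0 hb1 n0 (hnu n0))
  (renewal_top alpha beta (nu n) n0)).
Qed.

Let v_delta n : large n -> 0 < 1 - v n * delta n.
Proof.
case=> n0 _ h2; have /andP[v0 v1] := v01 n0.
have : v n * delta n <= v n * 2^-1 by rewrite ler_wpM2l// ltW.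
by lra.
Qed.

Let onem_q n : large n -> 1 - q n = v n * ((1 - delta n) / (1 - v n * delta n)).
Proof.
by move=> ln; rewrite /q /decay_rate -/(delta n); field; rewrite gt_eqF ?v_delta.
Qed.

Let q01 n : large n -> 0 < q n < 1.
Proof.
move=> ln; have [n0 _ h2] := ln; have /andP[v0 v1] := v01 n0.
rewrite [X in X && _]divr_gt0 ?subr_gt0//=; last by rewrite -subr_gt0; exact: v_delta.
rewrite -subr_gt0 onem_q// mulr_gt0// divr_gt0 ?v_delta//.
by move: h2; lra.
Qed.

Let cvgS : (fun n => S ^+ n) @ \oo --> (0 : R).
Proof. by apply: cvg_expr; rewrite ger0_norm ?(ltW s0). Qed.

Let cvgA : A @ \oo --> (0 : R).
Proof. by rewrite -(cvg_shiftS A). Qed.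

Let cvgv : v @ \oo --> (0 : R).
Proof.
apply: squeeze_cvgr cvgS; last exact: cvg_cst.
near=> n; have n0 : (0 < n)%N by near: n; exact: nbhs_infty_gt.
rewrite (stationary_top_le ha0 ha1 hb0 hb1 n0 (hnu n0)) andbT.
by apply: ltW; case/andP: (v01 n0).
Unshelve. all: by end_near. Qed.

Let cvg1v : (fun n => 1 - v n) @ \oo --> (1 : R).
Proof. by rewrite -[X in _ --> X]subr0; apply: cvgB => //; exact: cvg_cst. Qed.

Let cvgdelta : delta @ \oo --> (0 : R).
Proof.
rewrite -[X in _ --> X](mul0r (1 * (1 - rho))^-1); apply: cvgM => //.
apply: cvgV; first by rewrite mul1r gt_eqF.
by apply: cvgM => //; exact: cvg_cst.
Qed.

Let cvgC : C @ \oo --> (1 : R).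
Proof.
rewrite -[X in _ --> X]addr0; apply: cvgD; first exact: cvg_cst.
rewrite -[X in _ --> X](mul0r (1 - rho)^-1) -(mulr0 2).
by apply: cvgMl; apply: cvgMr.
Qed.

Let near_pos : \forall n \near \oo, (0 < n)%N. Proof. exact: nbhs_infty_gt. Qed.

Let near_large : \forall n \near \oo, large n.
Proof.
have h1 : \forall n \near \oo, delta n < 2^-1 by apply: (cvgr_lt _ cvgdelta); rewrite invr_gt0.
have h2 : \forall n \near \oo, S < rho * (1 - v n).
  have : (fun n => rho * (1 - v n)) @ \oo --> rho * 1 by apply: cvgMr.
  by move=> /cvgr_gt; apply; rewrite mulr1 /rho; move: s1; lra.
near=> n; split; first by near: n.
- by apply: ltW; near: n.
- by apply: ltW; near: n.
Unshelve. all: by end_near. Qed.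

Let cvgQS : (fun n => 1 - Q * S ^+ n) @ \oo --> (1 : R).
Proof.
rewrite -[X in _ --> X]subr0 -(mulr0 Q); apply: cvgB; first exact: cvg_cst.
exact: cvgMr.
Qed.

Let mv1 : (fun n => m n / v n) @ \oo --> (1 : R).
Proof.
apply: cvg_trans cvgQS; apply: near_eq_cvg; near=> n.
have n0 : (0 < n)%N by near: n.
rewrite /m mu_stationary//; last exact: hnu.
by rewrite -/(v n) [v n * _]mulrC mulfK// gt_eqF//; case/andP: (v01 n0).
Unshelve. all: by end_near. Qed.

Let cvgm : m @ \oo --> (0 : R).
Proof.
rewrite -[X in _ --> X](mul0r 1); apply: cvg_trans (cvgM cvgv cvgQS).
apply: near_eq_cvg; near=> n; rewrite /m mu_stationary//; first by near: n.
by apply: hnu; near: n.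
Unshelve. all: by end_near. Qed.

Let vq1 : (fun n => v n / (1 - q n)) @ \oo --> (1 : R).
Proof.
have : (fun n => (1 - v n * delta n) / (1 - delta n)) @ \oo --> ((1 - 0 * 0) / (1 - 0) : R).
  apply: cvgM; first by apply: cvgB; [exact: cvg_cst|exact: cvgM].
  apply: cvgV; first by rewrite subr0 oner_neq0.
  by apply: cvgB => //; exact: cvg_cst.
rewrite mul0r subr0 divr1; apply: cvg_trans; apply: near_eq_cvg; near=> n.
have ln : large n by near: n.
have [n0 _ h2] := ln; have /andP[v0 _] := v01 n0.
have d1 : 0 < 1 - delta n by move: h2; lra.
by rewrite onem_q//; field; rewrite !gt_eqF ?v_delta.
Unshelve. all: by end_near. Qed.

Let mq1 : (fun n => m n / (1 - q n)) @ \oo --> (1 : R).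
Proof.
rewrite -[X in _ --> X](mulr1 1); apply: cvg_trans (cvgM mv1 vq1).
apply: near_eq_cvg; near=> n; have n0 : (0 < n)%N by near: n.
rewrite /= mulrA divfK// gt_eqF//; by case/andP: (v01 n0).
Unshelve. all: by end_near. Qed.

Lemma mu_asympt : asympt m (fun n => (qpoch S)^-1 * (n`!%:R / n%:R ^+ n)
                      * Q ^+ n * S ^+ (n * n.+1)./2).
Proof.
have qp0 : qpoch S != 0 by rewrite gt_eqF// qpoch_gt0.
pose D n := \prod_(0 <= r < n) (1 - S ^+ r.+1 * (1 - r.+1%:R / n%:R)).
have : (fun n => qpoch S * (1 - Q * S ^+ n) / D n) @ \oo --> qpoch S * 1 / qpoch S.
  apply: cvgM; first exact: cvgMr.
  by apply: cvgV => //; exact: cvg_qprod_perturbed.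
rewrite mulr1 divff// /asympt; apply: cvg_trans; apply: near_eq_cvg; near=> n.
have n0 : (0 < n)%N by near: n.
have nR : (n%:R : R) != 0 by rewrite pnatr_eq0 -lt0n.
case/andP: Q01 => q0 _.
(* Numerator and denominator of [stationary_momE]: the shifts give the explicit monomial, the
   factors [1 - lam] give [D n]. *)
have vE : v n = (n`!%:R / n%:R ^+ n) * Q ^+ n * S ^+ (n * n.+1)./2 / D n.
  rewrite /v -mom_top (stationary_momE hb0 hb1 n0 (hnu n0))// big_split /=.
  rewrite prodfV; congr (_ / _).
  rewrite /momshift -/S -/Q big_split /= big_split /= [RHS]mulrC mulrA [RHS]mulrAC.
  congr (_ * _ * _).
  - rewrite prodrXr; congr (S ^+ _).
    have -> : (n * n.+1)./2 = 'C(n.+1, 2) by rewrite bin2 mulnC.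
    by rewrite -bin2_sum big_nat_recl// add0n.
  - by rewrite prodr_const_nat subn0.
  (* The factors [(n - i) / n] multiply to a full falling factorial over [n ^ n], that is
     [n! / n ^ n]. *)
  - rewrite -ffactnn ffact_prod natr_prod big_mkord -[n in n%:R ^+ n]card_ord.
    rewrite -prodr_const -prodf_div; apply: eq_bigr => i _.
    by rewrite card_ord natrB 1?ltnW//; field.
have Dn : D n != 0.
  by apply/eqP => D0; have /andP[] := v01 n0; rewrite vE D0 invr0 mulr0 ltxx.
rewrite /m mu_stationary//; last exact: hnu.
rewrite -/(v n) -/Q -/S vE; move: (D n) Dn => d Dn; field.
by rewrite Dn qp0 ?expf_neq0 ?(gt_eqF s0) ?(gt_eqF q0) ?nR ?pnatr_eq0 -?lt0n ?fact_gt0.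
Unshelve. all: by end_near. Qed.

(** [fine] would send [+oo] to [0]; [expect_scaled] shows that for [n > 0] the expectation is
    finite. *)
Definition moment n r : R := fine (expect alpha beta n (fun t => t%:R ^+ r)).

Lemma expect_scaled n r (c : R) : (0 < n)%N ->
  expect alpha beta n (fun t => (c * t%:R) ^+ r) = (c ^+ r * moment n r)%:E.
Proof.
move=> n0; have [C0 [x [C00 [x01 hx]]]] := collector_survival_geometric n0.
(* [expn_moment_le] asks for a constant at least [1]. *)
have hx' t : survival (f n) t <= Num.max 1 C0 * x ^+ t.
  apply: le_trans (hx t) _; rewrite ler_wpM2r ?le_max ?lexx ?orbT// exprn_ge0// ltW//.
  by case/andP: x01.
have C1 : 1 <= Num.max 1 C0 by rewrite le_max lexx.
have B := expn_moment_le (f := f n) erefl (f_ge0 n) x01 C1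
  (fun t => collector_survival_ge0 t n0) hx' r.
have u0 t : 0 <= t%:R ^+ r * f n t by rewrite mulr_ge0 ?exprn_ge0.
have [L [LE Lcvg _]] := nneseries_bounded u0 B.
have -> : moment n r = L by rewrite /moment /expect LE.
rewrite /expect; apply: cvg_lim => //.
under eq_fun do rewrite sumEFin.
apply: cvg_EFin; first by near=> N.
have -> : fine \o (fun N => (\sum_(0 <= t < N) (c * t%:R) ^+ r * pT alpha beta n t)%:E)
   = (fun N => c ^+ r * \sum_(0 <= t < N) t%:R ^+ r * f n t).
  apply/funext => N /=; rewrite mulr_sumr; apply: eq_bigr => t _.
  by rewrite exprMn mulrA.
exact: cvgMr.
Unshelve. all: by end_near. Qed.

(** Both bounds of [moment_bounds] scale to [(r + 1)!], since [m ~ v ~ 1 - q]; the lower-order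
    correction keeps a spare factor [m n], which tends to [0]. *)
Lemma cvg_moment r : (fun n => m n ^+ r.+1 * moment n r.+1) @ \oo --> ((r.+1)`!%:R : R).
Proof.
apply: (@squeeze_cvgr _ _ _ _
  (fun n => (r.+1)`!%:R * (m n / v n) ^+ r.+1
    - rising_defect R r * (m n * (C n * (r`!%:R * (m n / (1 - q n)) ^+ r))))
  (fun n => C n * ((r.+1)`!%:R * (m n / (1 - q n)) ^+ r.+1))).
- near=> n; have ln : large n by near: n.
  have [n0 _ _] := ln; have m0 := mu_gt0 n0.
  have [L [LE /andP[Lge Lle]]] := moment_bounds (f := f n) erefl (f_ge0 n) (q01 ln) (C_ge1 n)
    (fun t => collector_survival_ge0 t n0) (fun t => collector_survival_le t ln)
    (v01 n0) (fun t => collector_survival_ge t n0) r.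
  have -> : moment n r.+1 = L by rewrite /moment /expect LE.
  apply/andP; split.
    apply: le_trans (ler_wpM2l (exprn_ge0 r.+1 (ltW m0)) Lge).
    rewrite le_eqVlt; apply/orP; left; apply/eqP.
    by rewrite !expr_div_n [m n ^+ r.+1]exprS; ring.
  apply: le_trans (ler_wpM2l (exprn_ge0 r.+1 (ltW m0)) Lle) _.
  rewrite le_eqVlt; apply/orP; left; apply/eqP.
  by rewrite !expr_div_n; ring.
- rewrite [X in _ --> X](_ : _ = (r.+1)`!%:R * 1 ^+ r.+1
      - rising_defect R r * (0 * (1 * (r`!%:R * 1 ^+ r)))); last first.
    by rewrite expr1n mulr1 mul0r mulr0 subr0.
  apply: cvgB; first by apply: cvgMr; exact: cvgrX.
  by apply: cvgMr; apply: cvgM => //; apply: cvgM => //; apply: cvgMr; exact: cvgrX.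
- rewrite [X in _ --> X](_ : _ = 1 * ((r.+1)`!%:R * 1 ^+ r.+1)); last first.
    by rewrite expr1n mulr1 mul1r.
  by apply: cvgM => //; apply: cvgMr; exact: cvgrX.
Unshelve. all: by end_near. Qed.

Lemma expect_indicator n (x : R) : (0 < n)%N -> 0 <= x ->
  expect alpha beta n (fun t => if m n * t%:R <= x then 1 else 0) =
  (1 - survival (f n) (Num.truncn (x / m n)))%:E.
Proof.
move=> n0 x0; have m0 := mu_gt0 n0; set k := Num.truncn _.
have kE t : (m n * t%:R <= x) = (t <= k)%N.
  rewrite mulrC -ler_pdivlMr//.
  have /andP[h1 h2] := truncn_itv (divr_ge0 x0 (ltW m0)).
  apply/idP/idP => [tx|tk]; last by apply: le_trans h1; rewrite ler_nat.
  by rewrite -ltnS -(ltr_nat R); exact: le_lt_trans tx h2.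
rewrite /expect /survival subKr; apply: cvg_lim => //.
under eq_fun do rewrite sumEFin.
(* The partial sums are constant from [k.+1] on. *)
apply: cvg_near_cst; near=> N; congr (_%:E).
have kN : (k.+1 <= N)%N by near: N; exact: nbhs_infty_ge.
have tail : \sum_(k.+1 <= t < N) (if m n * t%:R <= x then 1 else 0) * pT alpha beta n t = 0.
  by rewrite big_nat big1// => t /andP[kt _]; rewrite kE leqNgt kt mul0r.
rewrite (big_cat_nat (n := k.+1))//= tail addr0.
by apply: eq_big_nat => t /andP[_ tk]; rewrite kE -ltnS tk mul1r.
Unshelve. all: by end_near. Qed.

Lemma expect_indicator_neg n (x : R) : (0 < n)%N -> x < 0 ->
  expect alpha beta n (fun t => if m n * t%:R <= x then 1 else 0) = 0%:E.
Proof.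
move=> n0 x0; rewrite /expect; apply: cvg_lim => //; apply: cvg_near_cst; near=> N.
apply: big1 => t _; rewrite leNgt (lt_le_trans x0) ?mul0r//.
by rewrite mulr_ge0// ltW// mu_gt0.
Unshelve. all: by end_near. Qed.

(** For [x >= 0] the distribution function is one minus the tail at [k n], the integer part of
    [x / m n]. The two geometric bounds have rates [v n] and [1 - q n], both equivalent to [m n], so
    [cvg_onem_pow] sends both to [expR (- x)]. *)
Lemma cvg_cdf (x : R) :
  (fun n => expect alpha beta n (fun t => if m n * t%:R <= x then 1 else 0))
    @ \oo --> (exp1_cdf x)%:E.
Proof.
rewrite /exp1_cdf; case: ltP => x0.
  by apply: cvg_near_cst; near=> n; rewrite expect_indicator_neg//; near: n.
pose k n := Num.truncn (x / m n).
have mk : (fun n => m n * (k n)%:R) @ \oo --> x.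
  apply: (@squeeze_cvgr _ _ _ _ (fun n => x - m n) (fun=> x)); last exact: cvg_cst.
    near=> n; have m0 : 0 < m n by apply: mu_gt0; near: n.
    have /andP[h1 h2] := truncn_itv (divr_ge0 x0 (ltW m0)).
    rewrite [m n * _]mulrC -ler_pdivlMr// h1 andbT.
    by move: h2; rewrite ltr_pdivrMr// -natr1 mulrDl mul1r -/(k n); lra.
  by rewrite -[X in _ --> X]subr0; apply: cvgB => //; exact: cvg_cst.
have scaled (a : nat -> R) : (\forall n \near \oo, 0 < a n) ->
    (fun n => m n / a n) @ \oo --> (1 : R) -> (fun n => a n * (k n)%:R) @ \oo --> x.
  move=> a0 ma; have am : (fun n => (m n / a n)^-1) @ \oo --> (1 : R).
    by rewrite -[X in _ --> X]invr1; apply: cvgV => //; rewrite oner_neq0.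
  rewrite -[x]mul1r; apply: cvg_trans (cvgM am mk); apply: near_eq_cvg; near=> n.
  have m0 : 0 < m n by apply: mu_gt0; near: n.
  have an0 : 0 < a n by near: n.
  by rewrite /=; field; rewrite !gt_eqF.
have vpos : \forall n \near \oo, 0 < v n.
  by near=> n; have /v01/andP[] : (0 < n)%N by near: n.
have qpos : \forall n \near \oo, 0 < 1 - q n.
  near=> n; rewrite subr_gt0; have ln : large n by near: n.
  by case/andP: (q01 ln).
have q0 : (fun n => 1 - q n) @ \oo --> (0 : R).
  have qm : (fun n => (m n / (1 - q n))^-1) @ \oo --> (1 : R).
    by rewrite -[X in _ --> X]invr1; apply: cvgV => //; rewrite oner_neq0.
  rewrite -[X in _ --> X](mul0r 1); apply: cvg_trans (cvgM cvgm qm); apply: near_eq_cvg; near=> n.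
  have m0 : 0 < m n by apply: mu_gt0; near: n.
  have an0 : 0 < 1 - q n by near: n.
  by rewrite /=; field; rewrite !gt_eqF.
apply/fine_cvgP; split.
  by near=> n; rewrite expect_indicator//; near: n.
have : (fun n => 1 - survival (f n) (k n)) @ \oo --> 1 - expR (- x).
  apply: cvgB; first exact: cvg_cst.
  apply: (@squeeze_cvgr _ _ _ _ (fun n => (1 - v n) ^+ k n)
     (fun n => C n * (1 - (1 - q n)) ^+ k n)).
  - near=> n; rewrite collector_survival_ge/=; last by near: n.
    by rewrite subKr; apply: collector_survival_le; near: n.
  - apply: cvg_onem_pow => //; last exact: scaled.
    by near=> n; apply: ltW; near: n.
  - rewrite -[X in _ --> X]mul1r; apply: cvgM => //.
    apply: cvg_onem_pow => //; last exact: scaled.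
    by near=> n; apply: ltW; near: n.
apply: cvg_trans; apply: near_eq_cvg; near=> n.
by rewrite /= expect_indicator//; near: n.
Unshelve. all: by end_near. Qed.

End CollectorAsymptotics.

(** * The limit law and moments, and the mean and variance deduced from them *)

Theorem mainTheorem8 (R : realType) (alpha beta : R)
  (ha0 : 0 <= alpha) (ha1 : alpha < 1) (hb0 : 0 < beta) (hb1 : beta < 1)
  (nu : nat -> nat -> R)
  (hnu : forall n, (0 < n)%N -> stationary alpha beta n (nu n)) :
  let Q := 1 - alpha in let S := 1 - beta in
  let m := fun n => mu alpha beta n (nu n) in
  (* mu_n ~ (1/(S;S)_oo) n!/n^n Q^n S^(n(n+1)/2) *)
  asympt m (fun n => (qpoch S)^-1 * (n`!%:R / n%:R ^+ n)
                      * Q ^+ n * S ^+ (n * n.+1)./2) /\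
  (* mu_n T_n => Exp(1): convergence of the distribution functions *)
  (forall x : R,
     (fun n => expect alpha beta n
                 (fun t => if m n * t%:R <= x then 1 else 0))
       @ \oo --> (exp1_cdf x)%:E) /\
  (* moments: E (mu_n T_n)^r -> r! *)
  (forall r : nat, (1 <= r)%N ->
     (fun n => expect alpha beta n (fun t => (m n * t%:R) ^+ r))
       @ \oo --> (r`!%:R : R)%:E) /\
  (* E T_n and E T_n^2 are finite *)
  (forall n, (0 < n)%N ->
     (expect alpha beta n (fun t => (t%:R)%R) < +oo)%E /\
     (expect alpha beta n (fun t => (t%:R ^+ 2)%R) < +oo)%E) /\
  (* E T_n ~ (S;S)_oo n^n/n! Q^-n S^-(n(n+1)/2) *)
  asympt (fun n => fine (expect alpha beta n (fun t => t%:R)))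
         (fun n => qpoch S * (n%:R ^+ n / n`!%:R) * Q ^- n * S ^- (n * n.+1)./2) /\
  (* Var T_n ~ (S;S)_oo^2 (n^n/n!)^2 Q^-2n S^-(n(n+1)) *)
  asympt (fun n => fine (expect alpha beta n (fun t => t%:R ^+ 2))
                   - fine (expect alpha beta n (fun t => t%:R)) ^+ 2)
         (fun n => qpoch S ^+ 2 * (n%:R ^+ n / n`!%:R) ^+ 2
                   * Q ^- (2 * n) * S ^- (n * n.+1)).
Proof.
move=> Q S m.
have E1 n : expect alpha beta n (fun t => t%:R) = expect alpha beta n (fun t => t%:R ^+ 1).
  by congr expect; apply/funext => t; rewrite expr1.
have Efin n r : (0 < n)%N -> (expect alpha beta n (fun t => (t%:R ^+ r)%R) < +oo)%E.
  move=> n0; have := expect_scaled ha0 ha1 hb0 hb1 hnu r 1 n0.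
  have -> : (fun t : nat => (1 * t%:R) ^+ r) = (fun t : nat => t%:R ^+ r) :> (nat -> R).
    by apply/funext => t; rewrite mul1r.
  by move=> ->; rewrite ltry.
have muA := mu_asympt ha0 ha1 hb0 hb1 hnu.
have near_pos : \forall n \near \oo, (0 < n)%N by exact: nbhs_infty_gt.
pose W n : R := (qpoch S)^-1 * (n`!%:R / n%:R ^+ n) * Q ^+ n * S ^+ (n * n.+1)./2.
have mom1 := cvg_moment ha0 ha1 hb0 hb1 hnu (r := 0%N).
have mom2 := cvg_moment ha0 ha1 hb0 hb1 hnu (r := 1%N).
have Wm : (fun n => (m n / W n)^-1) @ \oo --> (1 : R).
  by rewrite -[X in _ --> X]invr1; apply: cvgV => //; rewrite oner_neq0.
have m_gt0 n : (0 < n)%N -> 0 < m n by exact: mu_gt0.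
split; first exact: muA.
split; first exact: cvg_cdf.
split.
  case=> // r _; apply/fine_cvgP; split.
    by near=> n; rewrite (expect_scaled ha0 ha1 hb0 hb1 hnu)//; near: n.
  apply: cvg_trans (cvg_moment ha0 ha1 hb0 hb1 hnu (r := r)); apply: near_eq_cvg; near=> n.
  by rewrite /= (expect_scaled ha0 ha1 hb0 hb1 hnu)//; near: n.
split; first by move=> n n0; rewrite E1 !Efin.
have VW n : qpoch S * (n%:R ^+ n / n`!%:R) * Q ^- n * S ^- (n * n.+1)./2 = (W n)^-1.
  by rewrite /W !invfM !invrK [n`!%:R^-1 * _]mulrC.
have VW2 n : qpoch S ^+ 2 * (n%:R ^+ n / n`!%:R) ^+ 2 * Q ^- (2 * n) * S ^- (n * n.+1)
    = (W n)^-1 ^+ 2.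
  rewrite -VW !exprMn -!exprVn -!exprM [(2 * n)%N]mulnC.
  (* [n * n.+1] is even, so doubling its half is exact. *)
  congr (_ * _ ^+ _); rewrite muln2 -[LHS]odd_double_half.
  by rewrite oddM /= andbN.
split.
  rewrite /asympt -[X in _ --> X](mulr1 1).
  apply: cvg_trans (cvgM mom1 Wm); apply: near_eq_cvg; near=> n.
  have m0 : m n != 0 by rewrite gt_eqF// m_gt0//; near: n.
  rewrite /= VW E1 -/(moment alpha beta n 1) -/(m n) invrK invf_div.
  by move: (W n) => w; field.
rewrite /asympt.
(* The scaled variance tends to [2! - 1 ^ 2 = 1]; this needs the exact constants of both moments,
   not only their order. *)
have : (fun n => (m n ^+ 2 * moment alpha beta n 2 - (m n ^+ 1 * moment alpha beta n 1) ^+ 2)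
     * (m n / W n)^-1 ^+ 2) @ \oo --> ((2%:R - 1 ^+ 2) * 1 ^+ 2 : R).
  apply: cvgM; last exact: cvgrX.
  by apply: cvgB; [exact: mom2|apply: cvgrX; exact: mom1].
have -> : (2%:R - 1 ^+ 2) * 1 ^+ 2 = 1 :> R by ring.
apply: cvg_trans; apply: near_eq_cvg; near=> n.
have m0 : m n != 0 by rewrite gt_eqF// m_gt0//; near: n.
rewrite VW2 E1 -/(moment alpha beta n 1) -/(moment alpha beta n 2).
rewrite /= invf_div exprVn invrK; move: (W n) => w.
by field.
Unshelve. all: by end_near. Qed.
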